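(* Let $K$ be a finite subgroup of $\mathrm{Aut}(\hat{\mathbb{C}})$. Then $\hat{\mathbb{C}}$ admits a canonical Riemannian metric $\tilde g_K$ invariant by $K$, that coincides with the metric $g_{\hat{\mathbb{C}}}$ if $K$ is a subgroup of $SO(3)$.
   Context: $\hat{\mathbb{C}}=\mathbb{C}\cup\{\infty\}$ is the Riemann sphere and $\mathrm{Aut}(\hat{\mathbb{C}})\simeq PSL(2,\mathbb{C})$ is its group of biholomorphisms (Moebius transformations). $g_{\hat{\mathbb{C}}}$ is the standard metric of constant Gaussian curvature $1$ of the unit sphere $\mathbb{S}^2\subset\mathbb{R}^3$, transported to $\hat{\mathbb{C}}$ by stereographic projection; in the coordinate $z$ on $\mathbb{C}$ it is $\frac{4|dz|^2}{(1+|z|^2)^2}$, and it has the same form $\frac{4|du|^2}{(1+|u|^2)^2}$ in the coordinate $u=\frac{1}{z}$ near $\infty$. $SO(3)$, the group of rotations of $\mathbb{R}^3$, is regarded as a subgroup of $\mathrm{Aut}(\hat{\mathbb{C}})$ by transporting rotations of $\mathbb{S}^2$ to $\hat{\mathbb{C}}$ by stereographic projection. A Riemannian metric $g$ on $\hat{\mathbb{C}}$ is invariant by $K$ if $h^*g=g$ for all $h\in K$. *)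

(* Defs.v *)
From Stdlib Require Export Reals List.
From Coquelicot Require Export Coquelicot.

Open Scope R_scope.

(** * The Riemann sphere and its two affine charts *)

Inductive Chat : Type := Fin (z : C) | Inf.

(* [CZ] is the coordinate z on Chat \ {oo}; [CU] is u = 1/z on Chat \ {0},
   with u(oo) = 0.  Both charts have all of C as image. *)
Inductive chart : Type := CZ | CU.

Definition in_dom (c : chart) (p : Chat) : Prop :=
  match c with
  | CZ => p <> Inf
  | CU => p <> Fin (RtoC 0)
  end.

(* Total functions: the value is meaningful only for [p] in the domain of [c]. *)
Definition coord (c : chart) (p : Chat) : C :=
  match c, p with
  | CZ, Fin z => z
  | CZ, Inf => RtoC 0
  | CU, Fin z => Cinv z
  | CU, Inf => RtoC 0
  end.

(* The inverse of the chart [c], a bijection from C onto the domain of [c]. *)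
Definition param (c : chart) (x : C) : Chat :=
  match c with
  | CZ => Fin x
  | CU => if Req_EM_T (Cmod x) 0 then Inf else Fin (Cinv x)
  end.

Definition chart_at (p : Chat) : chart :=
  match p with
  | Fin _ => CZ
  | Inf => CU
  end.

(** * Biholomorphisms *)

(* The map [h] read in the chart [c] at the source and [d] at the target. *)
Definition in_charts (c d : chart) (h : Chat -> Chat) (x : C) : C :=
  coord d (h (param c x)).

(* Continuity of [h] is not a separate clause: near [x] the image stays in the
   domain of [d], and there the coordinate expression is complex
   differentiable, hence continuous, at [x]. *)
Definition holomorphic (h : Chat -> Chat) : Prop :=
  forall (c d : chart) (x : C),
    in_dom d (h (param c x)) ->
    locally (T := C_UniformSpace) x (fun y => in_dom d (h (param c y))) /\
    ex_derive (K := C_AbsRing) (V := C_NormedModule) (in_charts c d h) x.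

Definition inverse_maps (h k : Chat -> Chat) : Prop :=
  (forall p, h (k p) = p) /\ (forall p, k (h p) = p).

Definition Aut (h : Chat -> Chat) : Prop :=
  holomorphic h /\
  exists k : Chat -> Chat, holomorphic k /\ inverse_maps h k.

Definition finite_subgroup_Aut (K : (Chat -> Chat) -> Prop) : Prop :=
  (forall h, K h -> Aut h) /\
  K (fun p => p) /\
  (forall h k, K h -> K k -> K (fun p => h (k p))) /\
  (forall h, K h -> exists k, K k /\ inverse_maps h k) /\
  (exists l : list (Chat -> Chat), forall h, K h -> In h l).

(** * Riemannian metrics *)

(* Class C^n for real functions on the plane R^2 = C: by recursion, the two
   partial derivatives exist everywhere and are of class C^(n-1). *)
Fixpoint class_C (n : nat) (f : C -> R) : Prop :=
  match n with
  | O => forall z : C,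
      continuous (T := C_UniformSpace) (U := R_UniformSpace) f z
  | S m =>
      (forall x y : R, ex_derive (fun t : R => f (t, y)) x /\
                       ex_derive (fun t : R => f (x, t)) y) /\
      class_C m (fun z => Derive (fun t : R => f (t, snd z)) (fst z)) /\
      class_C m (fun z => Derive (fun t : R => f (fst z, t)) (snd z))
  end.

Definition smooth (f : C -> R) : Prop := forall n, class_C n f.

(* Covariant 2-tensor fields in charts: [g c x v w] is the value at the point
   [param c x] on the tangent vectors with components [v], [w] : C = R^2 in the
   chart [c]. *)
Definition tensor : Type := chart -> C -> C -> C -> R.

(* The last clause is the transformation law under z = 1/u, whose differential
   at u is multiplication by - 1/u^2. *)
Definition riemannian_metric (g : tensor) : Prop :=
  (forall c x (a : R) v v' w,
     g c x (Cplus (Cmult (RtoC a) v) v') w = a * g c x v w + g c x v' w) /\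
  (forall c x v w, g c x v w = g c x w v) /\
  (forall c x v, v <> RtoC 0 -> 0 < g c x v v) /\
  (forall c v w, smooth (fun x => g c x v w)) /\
  (forall (u v w : C), u <> RtoC 0 ->
     g CU u v w =
     g CZ (Cinv u) (Cmult (Copp (Cinv (Cmult u u))) v)
                   (Cmult (Copp (Cinv (Cmult u u))) w)).

(* The differential of a holomorphic [h], read in charts, is multiplication by
   the complex derivative.  For a metric [g] the choice of chart at the target
   is immaterial by the transformation law. *)
Definition pullback (h : Chat -> Chat) (g : tensor) : tensor :=
  fun c x v w =>
    let d := chart_at (h (param c x)) in
    let D := C_derive (in_charts c d h) x in
    g d (in_charts c d h x) (Cmult D v) (Cmult D w).

Definition invariant (K : (Chat -> Chat) -> Prop) (g : tensor) : Prop :=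
  forall h, K h -> pullback h g = g.

(* 4 |dz|^2 / (1 + |z|^2)^2, with the same expression in u. *)
Definition g_sphere : tensor :=
  fun _ x v w =>
    4 / (1 + Cmod x ^ 2) ^ 2 * (fst v * fst w + snd v * snd w).

(** * Rotations *)

Definition R3 : Type := (R * R * R)%type.

Definition dot3 (a b : R3) : R :=
  let '(a1, a2, a3) := a in
  let '(b1, b2, b3) := b in
  a1 * b1 + a2 * b2 + a3 * b3.

Definition cross3 (a b : R3) : R3 :=
  let '(a1, a2, a3) := a in
  let '(b1, b2, b3) := b in
  (a2 * b3 - a3 * b2, a3 * b1 - a1 * b3, a1 * b2 - a2 * b1).

(* 3 x 3 matrices, as the triple of their rows. *)
Definition M3 : Type := (R3 * R3 * R3)%type.

Definition mulmv3 (A : M3) (v : R3) : R3 :=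
  let '(r1, r2, r3) := A in (dot3 r1 v, dot3 r2 v, dot3 r3 v).

Definition det3 (A : M3) : R :=
  let '(r1, r2, r3) := A in dot3 r1 (cross3 r2 r3).

(* A A^T = I and det A = 1. *)
Definition SO3 (A : M3) : Prop :=
  let '(r1, r2, r3) := A in
  dot3 r1 r1 = 1 /\ dot3 r2 r2 = 1 /\ dot3 r3 r3 = 1 /\
  dot3 r1 r2 = 0 /\ dot3 r1 r3 = 0 /\ dot3 r2 r3 = 0 /\
  det3 A = 1.

(* Inverse stereographic projection from the north pole (0,0,1), a bijection
   from Chat onto the unit sphere. *)
Definition to_sphere (p : Chat) : R3 :=
  match p with
  | Fin z => (2 * fst z / (1 + Cmod z ^ 2),
              2 * snd z / (1 + Cmod z ^ 2),
              (Cmod z ^ 2 - 1) / (1 + Cmod z ^ 2))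
  | Inf => (0, 0, 1)
  end.

(* Automorphisms of Chat that correspond to a rotation of the unit sphere. *)
Definition SO3_Aut (h : Chat -> Chat) : Prop :=
  Aut h /\
  exists A : M3, SO3 A /\ forall p, to_sphere (h p) = mulmv3 A (to_sphere p).

(** * Canonicity *)

(* The conjugate subgroup r K r^-1 (for a bijection [r]). *)
Definition conj_subgroup (r : Chat -> Chat) (K : (Chat -> Chat) -> Prop) :
  (Chat -> Chat) -> Prop :=
  fun h => exists k, K k /\ forall p, h (r p) = r (k p).

(* A construction K |-> G K is canonical when it involves only the data
   (Chat, g_sphere, K): it is carried along by the automorphisms of
   (Chat, g_sphere), i.e. the elements r of SO(3), each of which is an
   isomorphism from (Chat, g_sphere, K) to (Chat, g_sphere, r K r^-1). *)
Definition canonical (G : ((Chat -> Chat) -> Prop) -> tensor) : Prop :=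
  forall (K : (Chat -> Chat) -> Prop) (r : Chat -> Chat),
    finite_subgroup_Aut K -> SO3_Aut r ->
    pullback r (G (conj_subgroup r K)) = G K.

(* Main.v *)
Require Import Defs.
From Stdlib Require Import Lra Lia Psatz.
From Stdlib Require Import ClassicalEpsilon FunctionalExtensionality Permutation.

(** The metric attached to [K] is the average of the round metric over [K],
    that is (1 / |K|) times the sum of the [k^* g_sphere] for [k] in [K].
    Pulling it back by an element [h] of [K] permutes the summands, because
    [h^* k^* = (k h)^*]; so it is invariant.  A rotation [r] fixes [g_sphere],
    hence carries the average over [r K r^-1] to the average over [K], and if
    [K] consists of rotations all summands are [g_sphere].  These are formal
    consequences of the chain rule ([pullback_comp]) and of
    [pullback_rotation]; the latter holds because a rotation preserves chordal
    distances, and a map that does so preserves their infinitesimal version,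
    the round metric.

    What has to be proved about automorphisms is that the summands are smooth.
    Holomorphy is only pointwise complex differentiability, so this is a
    regularity statement, and it is obtained from the classification: every
    automorphism is a Moebius transformation ([aut_is_moebius]).  For the
    matrix (a, b; c, d) the pulled back metric is
    4 |ad - bc|^2 |dz|^2 / (|az + b|^2 + |cz + d|^2)^2 ([pullback_moebius]),
    and smoothness, positivity and the change of chart can be read off.

    For the classification, composing with a Moebius transformation reduces to
    an automorphism that fixes infinity, i.e. to an entire function [f] such
    that [f z / z] has a limit [L] at infinity.  Such an [f] is affine
    ([entire_linear_growth]).  Indeed the difference quotient
    [q z = (f (z0 + z) - f z0) / z] tends to [f' z0] at 0 and to [L] at
    infinity, whereas its mean over the circle of radius [e^s] does not depend
    on [s]: in the coordinates (s, t) with [z = e^(s + i t)] this is the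
    vanishing of the integral of a closed form around the rectangle
    [a, b] x [0, 2 pi], whose horizontal sides cancel by periodicity.  So
    [f' z0 = L] for all [z0].  The closed form has coefficients that are only
    differentiable at each point, and the integral vanishes by Goursat's
    bisection argument ([green_goursat]). *)

(** * Green's theorem on rectangles for pointwise differentiable forms *)

(** The integral of the form [P dx + Q dy] around the rectangle
    [a, b] x [c, d], counterclockwise, with opposite sides grouped in one
    integrand so that their difference can be estimated pointwise. *)
Definition circulation (P Q : R -> R -> R) (a b c d : R) : R :=
  RInt (fun x => P x c - P x d) a b + RInt (fun y => Q b y - Q a y) c d.

Lemma differentiable_section_l (P : R -> R -> R) (x y lx ly : R) :
  differentiable_pt_lim P x y lx ly -> continuous (fun t => P t y) x.
Proof.
  intros H.
  apply (ex_derive_continuous (K := R_AbsRing) (V := R_NormedModule)).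
  exists (lx * 1 + ly * 0). apply is_derive_Reals.
  apply (derivable_pt_lim_comp_2d P (fun t => t) (fun _ => y)).
  - exact H.
  - apply derivable_pt_lim_id.
  - apply derivable_pt_lim_const.
Qed.

Lemma differentiable_section_r (P : R -> R -> R) (x y lx ly : R) :
  differentiable_pt_lim P x y lx ly -> continuous (fun t => P x t) y.
Proof.
  intros H.
  apply (ex_derive_continuous (K := R_AbsRing) (V := R_NormedModule)).
  exists (lx * 0 + ly * 1). apply is_derive_Reals.
  apply (derivable_pt_lim_comp_2d P (fun _ => x) (fun t => t)).
  - exact H.
  - apply derivable_pt_lim_const.
  - apply derivable_pt_lim_id.
Qed.

Lemma ex_RInt_diff (f g : R -> R) (a b : R) :
  (forall x, continuous f x) -> (forall x, continuous g x) ->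
  ex_RInt (fun x => f x - g x) a b.
Proof.
  intros Hf Hg. apply (ex_RInt_continuous (V := R_CompleteNormedModule)).
  intros z _. apply (continuous_minus (V := R_NormedModule)); auto.
Qed.

(** When a rectangle is cut, the integrals along the common side cancel; for
    the grouped integrands this is a telescoping of differences. *)
Lemma RInt_diff_Chasles (f g h : R -> R) (a b : R) :
  (forall x, continuous f x) -> (forall x, continuous g x) ->
  (forall x, continuous h x) ->
  RInt (fun x => f x - h x) a b =
  RInt (fun x => f x - g x) a b + RInt (fun x => g x - h x) a b.
Proof.
  intros Hf Hg Hh.
  rewrite <- (RInt_plus (V := R_CompleteNormedModule) (fun x => f x - g x))
    by (apply ex_RInt_diff; assumption).
  apply RInt_ext. intros x _. unfold plus; simpl. ring.
Qed.

Lemma circulation_split_x (P Q : R -> R -> R) (a e b c d : R) :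
  (forall x y, continuous (fun t => P t y) x) ->
  (forall x y, continuous (fun t => Q x t) y) ->
  circulation P Q a b c d = circulation P Q a e c d + circulation P Q e b c d.
Proof.
  intros HP HQ. unfold circulation.
  rewrite (RInt_diff_Chasles (Q b) (Q e) (Q a)) by (intros; apply HQ).
  rewrite <- (RInt_Chasles (V := R_CompleteNormedModule)
               (fun x => P x c - P x d) a e b)
    by (apply (ex_RInt_diff (fun t => P t c) (fun t => P t d));
        intros; apply HP).
  unfold plus; simpl. ring.
Qed.

Lemma circulation_split_y (P Q : R -> R -> R) (a b c e d : R) :
  (forall x y, continuous (fun t => P t y) x) ->
  (forall x y, continuous (fun t => Q x t) y) ->
  circulation P Q a b c d = circulation P Q a b c e + circulation P Q a b e d.
Proof.
  intros HP HQ. unfold circulation.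
  rewrite (RInt_diff_Chasles (fun t => P t c) (fun t => P t e) (fun t => P t d))
    by (intros; apply HP).
  rewrite <- (RInt_Chasles (V := R_CompleteNormedModule)
               (fun y => Q b y - Q a y) c e d)
    by (apply (ex_RInt_diff (Q b) (Q a)); intros; apply HQ).
  unfold plus; simpl. ring.
Qed.

Lemma RInt_near_const (f : R -> R) (a b k M : R) :
  a <= b -> (forall x, continuous f x) ->
  (forall t, a <= t <= b -> Rabs (f t - k) <= M) ->
  Rabs (RInt f a b - k * (b - a)) <= (b - a) * M.
Proof.
  intros Hab Hf HM.
  replace (k * (b - a)) with (RInt (fun _ : R => k) a b)
    by (rewrite RInt_const; unfold scal; simpl; unfold mult; simpl; ring).
  assert (Hk : forall x, continuous (fun _ : R => k) x)
    by (intros; apply continuous_const).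
  rewrite <- (RInt_minus (V := R_CompleteNormedModule) f (fun _ => k)).
  - apply abs_RInt_le_const; [exact Hab | apply ex_RInt_diff; auto | exact HM].
  - apply (ex_RInt_continuous (V := R_CompleteNormedModule)); auto.
  - apply (ex_RInt_continuous (V := R_CompleteNormedModule)); auto.
Qed.

(** Where the form is closed, its linear part contributes nothing: the
    [dx]-sides give [m (c - d) (b - a)] and the [dy]-sides the opposite.  What
    remains is the error of the linear approximation, of size [eps * s] along
    sides of length at most [s]. *)
Lemma circulation_local (P Q : R -> R -> R) (x y Px Qy m : R) (eps : posreal) :
  (forall x y, continuous (fun t => P t y) x) ->
  (forall x y, continuous (fun t => Q x t) y) ->
  differentiable_pt_lim P x y Px m -> differentiable_pt_lim Q x y m Qy ->
  exists delta : posreal, forall a b c d s : R,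
    a <= x <= b -> c <= y <= d -> b - a <= s -> d - c <= s -> s < delta ->
    Rabs (circulation P Q a b c d) <= 4 * eps * s ^ 2.
Proof.
  intros CP CQ HP HQ.
  destruct (HP eps) as [d1 H1]. destruct (HQ eps) as [d2 H2].
  exists (mkposreal _ (Rmin_stable_in_posreal d1 d2)).
  intros a b c d s Hx Hy Hab Hcd Hs; simpl in Hs.
  assert (s < d1) by (eapply Rlt_le_trans; [exact Hs | apply Rmin_l]).
  assert (s < d2) by (eapply Rlt_le_trans; [exact Hs | apply Rmin_r]).
  assert (Hmax : forall u v, a <= u <= b -> c <= v <= d ->
            Rabs (u - x) <= s /\ Rabs (v - y) <= s /\
            Rmax (Rabs (u - x)) (Rabs (v - y)) <= s).
  { intros u v Hu Hv.
    assert (Rabs (u - x) <= s) by (apply Rabs_le; lra).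
    assert (Rabs (v - y) <= s) by (apply Rabs_le; lra).
    repeat split; try assumption. apply Rmax_lub; assumption. }
  assert (E1 : forall u v, a <= u <= b -> c <= v <= d ->
            Rabs (P u v - P x y - (Px * (u - x) + m * (v - y))) <= eps * s).
  { intros u v Hu Hv. destruct (Hmax u v Hu Hv) as (A & B & D).
    eapply Rle_trans; [apply H1; lra|].
    apply Rmult_le_compat_l; [apply Rlt_le, eps | exact D]. }
  assert (E2 : forall u v, a <= u <= b -> c <= v <= d ->
            Rabs (Q u v - Q x y - (m * (u - x) + Qy * (v - y))) <= eps * s).
  { intros u v Hu Hv. destruct (Hmax u v Hu Hv) as (A & B & D).
    eapply Rle_trans; [apply H2; lra|].
    apply Rmult_le_compat_l; [apply Rlt_le, eps | exact D]. }
  assert (I1 : Rabs (RInt (fun u => P u c - P u d) a b - (m * (c - d)) * (b - a))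
               <= (b - a) * (2 * eps * s)).
  { apply RInt_near_const; [lra | |].
    - intros u. apply (continuous_minus (V := R_NormedModule)); apply CP.
    - intros t Ht.
      assert (A := E1 t c Ht ltac:(lra)). assert (B := E1 t d Ht ltac:(lra)).
      apply Rabs_le_between in A. apply Rabs_le_between in B.
      apply Rabs_le. split; nra. }
  assert (I2 : Rabs (RInt (fun v => Q b v - Q a v) c d - (m * (b - a)) * (d - c))
               <= (d - c) * (2 * eps * s)).
  { apply RInt_near_const; [lra | |].
    - intros u. apply (continuous_minus (V := R_NormedModule)); apply CQ.
    - intros t Ht.
      assert (A := E2 a t ltac:(lra) Ht). assert (B := E2 b t ltac:(lra) Ht).
      apply Rabs_le_between in A. apply Rabs_le_between in B.
      apply Rabs_le. split; nra. }
  assert (K : forall l, l <= s -> l * (2 * eps * s) <= 2 * eps * s ^ 2).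
  { intros l Hl. assert (0 <= 2 * eps * s)
      by (apply Rmult_le_pos; [assert (E := cond_pos eps); lra | lra]). nra. }
  assert (K1 := K _ Hab). assert (K2 := K _ Hcd).
  apply Rabs_le_between in I1. apply Rabs_le_between in I2.
  unfold circulation. apply Rabs_le. split; nra.
Qed.

Lemma circulation_quarter (P Q : R -> R -> R) (a c w h e : R) :
  (forall x y, continuous (fun t => P t y) x) ->
  (forall x y, continuous (fun t => Q x t) y) ->
  4 * e <= Rabs (circulation P Q a (a + 2 * w) c (c + 2 * h)) ->
  exists i j : R, (i = 0 \/ i = w) /\ (j = 0 \/ j = h) /\
    e <= Rabs (circulation P Q (a + i) (a + i + w) (c + j) (c + j + h)).
Proof.
  intros CP CQ He.
  rewrite (circulation_split_x P Q a (a + w)),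
    (circulation_split_y P Q a (a + w) c (c + h)),
    (circulation_split_y P Q (a + w) _ c (c + h)) in He by assumption.
  replace (a + 2 * w) with (a + w + w) in He by ring.
  replace (c + 2 * h) with (c + h + h) in He by ring.
  destruct (Rle_lt_dec e (Rabs (circulation P Q a (a + w) c (c + h)))).
  { exists 0, 0. rewrite !Rplus_0_r. auto. }
  destruct (Rle_lt_dec e (Rabs (circulation P Q (a + w) (a + w + w) c (c + h)))).
  { exists w, 0. rewrite !Rplus_0_r. auto. }
  destruct (Rle_lt_dec e (Rabs (circulation P Q a (a + w) (c + h) (c + h + h)))).
  { exists 0, h. rewrite !Rplus_0_r. auto. }
  exists w, h. repeat split; auto.
  apply Rnot_lt_le; intros N.
  apply Rabs_lt_between in r. apply Rabs_lt_between in r0.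
  apply Rabs_lt_between in r1. apply Rabs_lt_between in N.
  revert He. apply Rlt_not_le, Rabs_lt_between. lra.
Qed.

(** The left endpoints of nested intervals of lengths [w / 2 ^ n] converge to
    a point that lies in all of them. *)
Lemma nested_limit (u : nat -> R) (w : R) :
  0 <= w ->
  (forall n, u n <= u (S n) <= u n + w / 2 ^ S n) ->
  exists l, forall n, u n <= l <= u n + w / 2 ^ n.
Proof.
  intros Hw Hu.
  assert (P2 : forall n, 0 < 2 ^ n) by (intros; apply pow_lt; lra).
  assert (half : forall n, w / 2 ^ n = 2 * (w / 2 ^ S n)).
  { intros n. simpl. field. apply Rgt_not_eq, P2. }
  destruct (ex_lim_seq_adj u (fun n => u n + w / 2 ^ n)) as (Eu & Ev & E).
  - intros n. apply Hu.
  - intros n. rewrite (half n). specialize (Hu n). lra.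
  - apply is_lim_seq_ext with (fun n => w * (/ 2) ^ n).
    { intros n. rewrite pow_inv. unfold Rdiv. ring. }
    replace (Finite 0) with (Rbar_mult w 0) by (simpl; f_equal; ring).
    apply is_lim_seq_scal_l, is_lim_seq_geom. rewrite Rabs_pos_eq; lra.
  - destruct Eu as [l Hl]. destruct Ev as [l' Hl'].
    rewrite (is_lim_seq_unique _ _ Hl), (is_lim_seq_unique _ _ Hl') in E.
    injection E as <-. exists l. intros n. split.
    + apply is_lim_seq_incr_compare; [exact Hl |]. intros k; apply Hu.
    + apply (is_lim_seq_decr_compare (fun n => u n + w / 2 ^ n)); [exact Hl' |].
      intros k. rewrite (half k). specialize (Hu k). lra.
Qed.

(** Goursat's argument.  If the circulation around the rectangle were [e] in
    absolute value, one of the four quarters would have at least [e / 4], and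
    so on; the nested rectangles shrink to a point, where
    [circulation_local] bounds the [n]-th circulation by an arbitrarily small
    multiple of [1 / 4 ^ n]. *)
Theorem green_goursat (P Q Px Qy m : R -> R -> R) :
  (forall x y, differentiable_pt_lim P x y (Px x y) (m x y)) ->
  (forall x y, differentiable_pt_lim Q x y (m x y) (Qy x y)) ->
  forall a b c d, a <= b -> c <= d -> circulation P Q a b c d = 0.
Proof.
  intros HP HQ a b c d Hab Hcd.
  assert (CP : forall x y, continuous (fun t => P t y) x).
  { intros x y. eapply differentiable_section_l, HP. }
  assert (CQ : forall x y, continuous (fun t => Q x t) y).
  { intros x y. eapply differentiable_section_r, HQ. }
  apply Rabs_eq_0. apply Rle_antisym; [| apply Rabs_pos].
  apply Rnot_lt_le; intros He.
  set (e := Rabs (circulation P Q a b c d)) in He.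
  set (w := b - a). set (h := d - c).
  assert (P2 : forall n, 0 < 2 ^ n) by (intros; apply pow_lt; lra).
  assert (P4 : forall n, 0 < 4 ^ n) by (intros; apply pow_lt; lra).
  (* Rectangles of generation [n] all have sides [w / 2 ^ n] and [h / 2 ^ n],
     so that they are determined by their lower left corner. *)
  pose (big := fun (n : nat) (p : R * R) =>
    e / 4 ^ n <= Rabs (circulation P Q (fst p) (fst p + w / 2 ^ n)
                                       (snd p) (snd p + h / 2 ^ n))).
  assert (step : forall n p, exists p', big n p ->
     big (S n) p' /\
     fst p <= fst p' <= fst p + w / 2 ^ S n /\
     snd p <= snd p' <= snd p + h / 2 ^ S n).
  { intros n [x y]. destruct (classic (big n (x, y))) as [B | B];
      [| exists (x, y); tauto].
    unfold big in B; simpl fst in B; simpl snd in B.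
    replace (e / 4 ^ n) with (4 * (e / 4 ^ S n)) in B
      by (simpl; field; apply Rgt_not_eq, P4).
    replace (w / 2 ^ n) with (2 * (w / 2 ^ S n)) in B
      by (simpl; field; apply Rgt_not_eq, P2).
    replace (h / 2 ^ n) with (2 * (h / 2 ^ S n)) in B
      by (simpl; field; apply Rgt_not_eq, P2).
    destruct (circulation_quarter _ _ _ _ _ _ _ CP CQ B)
      as (i & j & Hi & Hj & B').
    exists (x + i, y + j). intros _. split; [exact B' | simpl fst; simpl snd].
    assert (0 <= w / 2 ^ S n)
      by (apply Rdiv_le_0_compat; [unfold w; lra | apply P2]).
    assert (0 <= h / 2 ^ S n)
      by (apply Rdiv_le_0_compat; [unfold h; lra | apply P2]).
    destruct Hi as [-> | ->], Hj as [-> | ->]; lra. }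
  pose (next := fun n p =>
    proj1_sig (constructive_indefinite_description _ (step n p))).
  assert (Hnext : forall n p, big n p ->
     big (S n) (next n p) /\
     fst p <= fst (next n p) <= fst p + w / 2 ^ S n /\
     snd p <= snd (next n p) <= snd p + h / 2 ^ S n).
  { intros n p. exact (proj2_sig (constructive_indefinite_description _ (step n p))). }
  pose (corner := fix corner n := match n with
                   | O => (a, c) | S k => next k (corner k) end).
  assert (Hbig : forall n, big n (corner n)).
  { induction n as [| n IH]; [| apply (Hnext n _ IH)].
    unfold big, corner, w, h; simpl.
    rewrite !Rdiv_1_r. replace (a + (b - a)) with b by ring.
    replace (c + (d - c)) with d by ring. apply Rle_refl. }
  destruct (nested_limit (fun n => fst (corner n)) w) as [x Hx].
  { unfold w; lra. } { intros n. apply (Hnext n _ (Hbig n)). }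
  destruct (nested_limit (fun n => snd (corner n)) h) as [y Hy].
  { unfold h; lra. } { intros n. apply (Hnext n _ (Hbig n)). }
  (* Bounds both sides of the initial rectangle; the summand 1 keeps it positive
     when the rectangle is degenerate. *)
  set (W := w + h + 1).
  assert (HW : 0 < W) by (unfold W, w, h; lra).
  (* With this precision the local bound [4 * eps * (W / 2 ^ n) ^ 2] is half of
     the lower bound [e / 4 ^ n]. *)
  assert (Heps : 0 < e / (8 * W ^ 2)).
  { apply Rdiv_lt_0_compat; [exact He |]. assert (0 < W ^ 2) by (apply pow_lt; lra). lra. }
  destruct (circulation_local P Q x y (Px x y) (Qy x y) (m x y)
              (mkposreal _ Heps) CP CQ (HP x y) (HQ x y)) as [delta Hd].
  assert (Hn : exists n, W / 2 ^ n < delta).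
  { destruct (pow_lt_1_zero (/ 2) ltac:(rewrite Rabs_pos_eq; lra) (delta / W))
      as [n Hn].
    { apply Rdiv_lt_0_compat; [apply delta | exact HW]. }
    exists n. specialize (Hn n (Nat.le_refl n)).
    rewrite Rabs_pos_eq, pow_inv in Hn
      by (apply pow_le; lra).
    apply (Rmult_lt_compat_l W) in Hn; [| exact HW].
    replace (W * (delta / W)) with (pos delta) in Hn by (field; lra).
    exact Hn. }
  destruct Hn as [n Hn].
  assert (Hle : forall v, v <= W -> v / 2 ^ n <= W / 2 ^ n).
  { intros v Hv. apply Rmult_le_compat_r; [| exact Hv].
    apply Rlt_le, Rinv_0_lt_compat, P2. }
  assert (B := Hbig n). unfold big in B.
  assert (L := Hd (fst (corner n)) (fst (corner n) + w / 2 ^ n)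
                  (snd (corner n)) (snd (corner n) + h / 2 ^ n) (W / 2 ^ n)
                  (Hx n) (Hy n)).
  lapply L; [clear L; intros L |
    ring_simplify; apply Hle; unfold W, w, h; lra].
  lapply L; [clear L; intros L |
    ring_simplify; apply Hle; unfold W, w, h; lra].
  specialize (L Hn). change (pos (mkposreal _ Heps)) with (e / (8 * W ^ 2)) in L.
  assert (F := Rle_trans _ _ _ B L).
  replace (4 * (e / (8 * W ^ 2)) * (W / 2 ^ n) ^ 2) with (e / 4 ^ n / 2) in F.
  - assert (0 < e / 4 ^ n) by (apply Rdiv_lt_0_compat; [exact He | apply P4]). lra.
  - replace (4 ^ n) with ((2 ^ n) ^ 2) by
      (rewrite <- pow_mult, Nat.mul_comm, pow_mult;
       replace (2 ^ 2) with 4 by ring; reflexivity).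
    field. split; [apply Rgt_not_eq, P2 | lra].
Qed.

(** * Complex differentiation *)

(** Complex differentiability for the normed space structure [C_NormedModule]
    on the target, the one in the definition of [holomorphic]. *)
Definition C_derive_at (f : C -> C) (z l : C) : Prop :=
  is_derive (K := C_AbsRing) (V := C_NormedModule) f z l.

Lemma C_near (z : C) (P : C -> Prop) :
  locally (T := C_UniformSpace) z P <->
  exists d, 0 < d /\ forall w, Cmod (w - z) < d -> P w.
Proof.
  split.
  - intros H. apply locally_C in H. destruct H as [d Hd].
    exists d. split; [apply d | exact Hd].
  - intros (d & Hd & H). apply locally_C. exists (mkposreal d Hd). exact H.
Qed.

Lemma C_derive_at_eps (f : C -> C) (z l : C) :
  C_derive_at f z l <->
  forall eps, 0 < eps -> exists d, 0 < d /\ forall w, Cmod (w - z) < d ->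
    Cmod (f w - f z - l * (w - z)) <= eps * Cmod (w - z).
Proof.
  split.
  - intros [_ H] eps Heps.
    destruct (H z (fun P HP => HP) (mkposreal eps Heps)) as [d Hd].
    exists d. split; [apply d |]. intros w Hw.
    replace (l * (w - z))%C with ((w - z) * l)%C by ring.
    exact (Hd w Hw).
  - intros H. split; [apply (is_linear_scal_l (K := C_AbsRing) (V := C_NormedModule)) |].
    intros y Hy eps.
    assert (E : y = z).
    { symmetry. apply is_filter_lim_locally_unique. exact Hy. }
    subst y.
    destruct (H eps (cond_pos eps)) as (d & Hd & Hw).
    exists (mkposreal d Hd). intros w Hball.
    specialize (Hw w Hball).
    replace (l * (w - z))%C with ((w - z) * l)%C in Hw by ring.
    exact Hw.
Qed.

(** The product rule and the chain rule are available for the target [C] seen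
    as a normed module over itself; its norm, hence its derivatives, are the
    same. *)
Lemma C_derive_at_abs (f : C -> C) (z l : C) :
  C_derive_at f z l <->
  is_derive (K := C_AbsRing) (V := AbsRing_NormedModule C_AbsRing) f z l.
Proof. split; intros [[H1 H2 H3] H]; split; try split; assumption. Qed.

Lemma C_derive_at_unique (f : C -> C) (z l : C) :
  C_derive_at f z l -> C_derive f z = l.
Proof. apply is_C_derive_unique. Qed.

Lemma C_derive_at_inj (f : C -> C) (z l m : C) :
  C_derive_at f z l -> C_derive_at f z m -> l = m.
Proof.
  intros H1 H2. rewrite <- (C_derive_at_unique _ _ _ H1).
  apply C_derive_at_unique, H2.
Qed.

Lemma C_derive_at_near (f g : C -> C) (z l : C) :
  locally (T := C_UniformSpace) z (fun w => f w = g w) ->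
  C_derive_at f z l -> C_derive_at g z l.
Proof.
  intros H. apply is_derive_ext_loc. apply locally_C. exact H.
Qed.

Lemma C_derive_at_ext (f g : C -> C) (z l : C) :
  (forall w, f w = g w) -> C_derive_at f z l -> C_derive_at g z l.
Proof. intros H. apply is_derive_ext. exact H. Qed.

Lemma C_derive_at_const (a z : C) : C_derive_at (fun _ => a) z (RtoC 0).
Proof. apply (is_derive_const (K := C_AbsRing) (V := C_NormedModule)). Qed.

Lemma C_derive_at_id (z : C) : C_derive_at (fun w => w) z (RtoC 1).
Proof. apply C_derive_at_abs, (is_derive_id (K := C_AbsRing)). Qed.

Lemma C_derive_at_plus (f g : C -> C) (z l m : C) :
  C_derive_at f z l -> C_derive_at g z m ->
  C_derive_at (fun w => f w + g w)%C z (l + m)%C.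
Proof. apply (is_derive_plus (K := C_AbsRing) (V := C_NormedModule)). Qed.

Lemma C_derive_at_mult (f g : C -> C) (z l m : C) :
  C_derive_at f z l -> C_derive_at g z m ->
  C_derive_at (fun w => f w * g w)%C z (l * g z + f z * m)%C.
Proof.
  intros Hf%C_derive_at_abs Hg%C_derive_at_abs. apply C_derive_at_abs.
  apply (is_derive_mult (K := C_AbsRing)); [exact Hf | exact Hg |].
  intros; apply Cmult_comm.
Qed.

Lemma C_derive_at_comp (f g : C -> C) (z l m : C) :
  C_derive_at f (g z) l -> C_derive_at g z m ->
  C_derive_at (fun w => f (g w)) z (l * m)%C.
Proof.
  intros Hf Hg%C_derive_at_abs. rewrite Cmult_comm.
  exact (is_derive_comp (K := C_AbsRing) (V := C_NormedModule) f g z l m Hf Hg).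
Qed.

Lemma C_derive_at_continuous (f : C -> C) (z l : C) :
  C_derive_at f z l ->
  forall eps, 0 < eps -> exists d, 0 < d /\ forall w, Cmod (w - z) < d ->
    Cmod (f w - f z) < eps.
Proof.
  intros H eps Heps.
  destruct (proj1 (C_derive_at_eps f z l) H 1 Rlt_0_1) as (d & Hd & Hw).
  assert (0 <= Cmod l) by apply Cmod_ge_0.
  exists (Rmin d (eps / (Cmod l + 1))). split.
  { apply Rmin_glb_lt; [exact Hd | apply Rdiv_lt_0_compat; lra]. }
  intros w Hlt.
  assert (H1 := Rlt_le_trans _ _ _ Hlt (Rmin_l _ _)).
  assert (H2 := Rlt_le_trans _ _ _ Hlt (Rmin_r _ _)).
  specialize (Hw w H1).
  replace (f w - f z)%C with ((f w - f z - l * (w - z)) + l * (w - z))%C by ring.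
  eapply Rle_lt_trans; [apply Cmod_triangle |]. rewrite Cmod_mult.
  apply Rle_lt_trans with ((Cmod l + 1) * Cmod (w - z)); [lra |].
  apply (Rmult_lt_compat_l (Cmod l + 1)) in H2; [| lra].
  replace ((Cmod l + 1) * (eps / (Cmod l + 1))) with eps in H2 by (field; lra).
  exact H2.
Qed.

Lemma C_derive_at_near_neq (f : C -> C) (z l a : C) :
  C_derive_at f z l -> f z <> a ->
  locally (T := C_UniformSpace) z (fun w => f w <> a).
Proof.
  intros H Ha. apply C_near.
  assert (Hp : 0 < Cmod (a - f z)).
  { apply Cmod_gt_0. intros E. apply Ha.
    replace a with ((a - f z) + f z)%C by ring. rewrite E. ring. }
  destruct (C_derive_at_continuous f z l H _ Hp) as (d & Hd & Hw).
  exists d. split; [exact Hd |]. intros w Hlt E.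
  specialize (Hw w Hlt). rewrite E in Hw. exact (Rlt_irrefl _ Hw).
Qed.

(** The remainder [1/w - 1/z + (w - z)/z^2] equals [(w - z)^2 / (w z^2)], and
    [|w| >= |z| / 2] for [w] close to [z]. *)
Lemma C_derive_at_Cinv (z : C) :
  z <> RtoC 0 -> C_derive_at Cinv z (- / (z * z))%C.
Proof.
  intros Hz. apply C_derive_at_eps. intros eps Heps.
  assert (Hm : 0 < Cmod z) by (apply Cmod_gt_0; exact Hz).
  set (M := Cmod z) in *.
  assert (H3 : 0 < M ^ 3) by (apply pow_lt; exact Hm).
  exists (Rmin (M / 2) (eps * M ^ 3 / 2)). split.
  { apply Rmin_glb_lt; [lra |]. apply Rdiv_lt_0_compat; [nra | lra]. }
  intros w Hlt.
  assert (H1 := Rlt_le_trans _ _ _ Hlt (Rmin_l _ _)).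
  assert (H2 := Rlt_le_trans _ _ _ Hlt (Rmin_r _ _)).
  assert (Hw : M / 2 <= Cmod w).
  { assert (T := Cmod_triangle (z - w) w).
    replace (z - w + w)%C with z in T by ring.
    replace (z - w)%C with (- (w - z))%C in T by ring.
    rewrite Cmod_opp in T. fold M in T. lra. }
  assert (Hw0 : w <> RtoC 0).
  { apply Cmod_gt_0. lra. }
  replace (/ w - / z - - / (z * z) * (w - z))%C
    with (/ (w * (z * z)) * ((w - z) * (w - z)))%C by (field; auto).
  assert (Hzz : (z * z)%C <> RtoC 0) by (apply Cmult_neq_0; auto).
  assert (Hwzz : (w * (z * z))%C <> RtoC 0) by (apply Cmult_neq_0; auto).
  rewrite Cmod_mult, Cmod_inv, !Cmod_mult by exact Hwzz. fold M.
  rewrite <- Rmult_assoc. apply Rmult_le_compat_r; [apply Cmod_ge_0 |].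
  set (r := Cmod (w - z)) in *. set (N := Cmod w) in *.
  assert (HN : 0 < N * (M * M)) by (apply Rmult_lt_0_compat; nra).
  apply Rmult_le_reg_l with (N * (M * M)); [exact HN |].
  rewrite <- Rmult_assoc, Rinv_r, Rmult_1_l by lra.
  assert (M ^ 3 / 2 <= N * (M * M)) by nra. nra.
Qed.

Lemma C_derive_at_quotient (f g : C -> C) (z l m : C) :
  C_derive_at f z l -> C_derive_at g z m -> g z <> RtoC 0 ->
  C_derive_at (fun w => f w / g w)%C z
    ((l * g z - f z * m) / (g z * g z))%C.
Proof.
  intros Hf Hg H0.
  replace ((l * g z - f z * m) / (g z * g z))%C
    with (l * / g z + f z * (- / (g z * g z) * m))%C by (field; exact H0).
  apply (C_derive_at_mult f (fun w => / g w)%C); [exact Hf |].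
  apply (C_derive_at_comp Cinv g); [| exact Hg].
  apply C_derive_at_Cinv, H0.
Qed.

(** The Cauchy-Riemann equations: multiplication by [l] has the matrix
    (Re l, - Im l; Im l, Re l). *)
Lemma C_derive_at_real (f : C -> C) (x y : R) (l : C) :
  C_derive_at f (x, y) l ->
  differentiable_pt_lim (fun s t => fst (f (s, t))) x y (fst l) (- snd l) /\
  differentiable_pt_lim (fun s t => snd (f (s, t))) x y (snd l) (fst l).
Proof.
  intros H.
  assert (K : forall eps : posreal, exists d : posreal, forall u v,
    Rabs (u - x) < d -> Rabs (v - y) < d ->
    Cmod (f (u, v) - f (x, y) - l * ((u, v) - (x, y))) <=
    eps * Rmax (Rabs (u - x)) (Rabs (v - y))).
  { intros eps.
    assert (S2 : 0 < sqrt 2) by (apply sqrt_lt_R0; lra).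
    assert (He : 0 < eps / sqrt 2) by (apply Rdiv_lt_0_compat; [apply eps | exact S2]).
    destruct (proj1 (C_derive_at_eps _ _ _) H _ He) as (d & Hd & Hw).
    assert (Hd' : 0 < d / sqrt 2) by (apply Rdiv_lt_0_compat; assumption).
    exists (mkposreal _ Hd'). intros u v Hu Hv. simpl in Hu, Hv.
    assert (B := Cmod_2Rmax ((u, v) - (x, y))%C). simpl in B.
    fold (u - x) in B. fold (v - y) in B.
    assert (Hmax : Rmax (Rabs (u - x)) (Rabs (v - y)) < d / sqrt 2)
      by (apply Rmax_lub_lt; assumption).
    eapply Rle_trans; [apply Hw |].
    - eapply Rle_lt_trans; [exact B |].
      apply (Rmult_lt_compat_l (sqrt 2)) in Hmax; [| exact S2].
      replace (sqrt 2 * (d / sqrt 2)) with d in Hmax by (field; lra). exact Hmax.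
    - apply (Rmult_le_compat_l (eps / sqrt 2)) in B; [| lra].
      eapply Rle_trans; [exact B |]. apply Req_le. field. lra. }
  split; intros eps; destruct (K eps) as [d Hd]; exists d; intros u v Hu Hv;
    eapply Rle_trans; [| apply (Hd u v Hu Hv) | | apply (Hd u v Hu Hv)].
  - eapply Rle_trans; [| apply re_le_Cmod]. apply Req_le. f_equal.
    destruct l; unfold Re; simpl. ring.
  - eapply Rle_trans; [| eapply Rle_trans; [apply Rmax_r | apply Rmax_Cmod]].
    apply Req_le. f_equal. destruct l; simpl. ring.
Qed.

(** * Entire functions of linear growth *)

Definition polar (s t : R) : C := (exp s * cos t, exp s * sin t).

Lemma Cmod_polar (s t : R) : Cmod (polar s t) = exp s.
Proof.
  unfold Cmod, polar. simpl fst; simpl snd.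
  replace ((exp s * cos t) ^ 2 + (exp s * sin t) ^ 2) with (exp s ^ 2).
  - apply sqrt_pow2, Rlt_le, exp_pos.
  - assert (E := sin2_cos2 t). unfold Rsqr in E. 
    transitivity (exp s ^ 2 * (sin t * sin t + cos t * cos t)); [rewrite E |]; ring.
Qed.

Lemma polar_neq_0 (s t : R) : polar s t <> RtoC 0.
Proof. apply Cmod_gt_0. rewrite Cmod_polar. apply exp_pos. Qed.

Lemma polar_period (s : R) : polar s 0 = polar s (2 * PI).
Proof. unfold polar. rewrite cos_0, sin_0, cos_2PI, sin_2PI. reflexivity. Qed.

Lemma differentiable_exp_times (g : R -> R) (dg s t : R) :
  (forall t, continuous g t) -> is_derive g t dg ->
  differentiable_pt_lim (fun s t => exp s * g t) s t (exp s * g t) (exp s * dg).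
Proof.
  intros Cg Dg. apply filterdiff_differentiable_pt_lim.
  eapply filterdiff_ext_lin.
  - apply (is_derive_filterdiff (fun s t => exp s * g t) s t
             (fun s t => exp s * g t) (exp s * dg)).
    + apply filter_forall. intros [a b]. simpl.
      auto_derive; [exact I | ring].
    + apply is_derive_scal. exact Dg.
    + apply (continuous_mult (K := R_AbsRing) (fun u : R * R => exp (fst u)) (fun u => g (snd u))).
      * apply (continuous_comp fst exp); [apply continuous_fst |].
        apply (ex_derive_continuous (K := R_AbsRing) (V := R_NormedModule)). auto_derive. exact I.
      * apply (continuous_comp snd g); [apply continuous_snd | apply Cg].
  - intros [a b]. unfold plus, scal; simpl. unfold mult; simpl. ring.
Qed.

(** In the coordinates [s + i t = log z] the form
    [Im q ds + Re q dt] is closed by the Cauchy-Riemann equations, and its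
    integrals along [t = 0] and [t = 2 pi] agree.  Green's theorem thus equates
    its integrals along [s = a] and [s = b]. *)
Lemma circle_integral_constant (q q' : C -> C) :
  (forall z, z <> RtoC 0 -> C_derive_at q z (q' z)) ->
  forall a b, a <= b ->
  RInt (fun t => fst (q (polar b t)) - fst (q (polar a t))) 0 (2 * PI) = 0.
Proof.
  intros Hq a b Hab.
  pose (D := fun s t => q' (polar s t)).
  assert (Dcos : forall s t,
    differentiable_pt_lim (fun s t => exp s * cos t) s t (exp s * cos t) (exp s * - sin t)).
  { intros s t. apply differentiable_exp_times.
    - intros u. apply (ex_derive_continuous (K := R_AbsRing) (V := R_NormedModule)).
      auto_derive. exact I.
    - auto_derive; [exact I | ring]. }
  assert (Dsin : forall s t,
    differentiable_pt_lim (fun s t => exp s * sin t) s t (exp s * sin t) (exp s * cos t)).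
  { intros s t. apply differentiable_exp_times.
    - intros u. apply (ex_derive_continuous (K := R_AbsRing) (V := R_NormedModule)).
      auto_derive. exact I.
    - auto_derive; [exact I | ring]. }
  assert (G := green_goursat
    (fun s t => snd (q (polar s t))) (fun s t => fst (q (polar s t)))
    (fun s t => snd (D s t) * (exp s * cos t) + fst (D s t) * (exp s * sin t))
    (fun s t => fst (D s t) * (exp s * - sin t) + - snd (D s t) * (exp s * cos t))
    (fun s t => fst (D s t) * (exp s * cos t) + - snd (D s t) * (exp s * sin t))).
  specialize (fun A B => G A B a b 0 (2 * PI) Hab).
  lapply G; clear G.
  - intros G. lapply G; clear G.
    + intros G. assert (HPI := PI_RGT_0). specialize (G ltac:(lra)).
      unfold circulation in G. rewrite (RInt_ext _ (fun _ => 0)) in G.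
      * rewrite RInt_const in G. unfold scal in G; simpl in G.
        unfold mult in G; simpl in G. rewrite Rmult_0_r, Rplus_0_l in G. exact G.
      * intros x _. simpl. rewrite polar_period. apply Rminus_diag_eq. reflexivity.
    + intros s t.
      destruct (C_derive_at_real q _ _ _ (Hq (polar s t) (polar_neq_0 s t))) as [A _].
      exact (differentiable_pt_lim_comp _ _ _ _ _ _ _ _ _ _ _ A (Dcos s t) (Dsin s t)).
  - intros s t.
    destruct (C_derive_at_real q _ _ _ (Hq (polar s t) (polar_neq_0 s t))) as [_ A].
    replace (fst (D s t) * (exp s * cos t) + - snd (D s t) * (exp s * sin t))
      with (snd (D s t) * (exp s * - sin t) + fst (D s t) * (exp s * cos t)) by ring.
    exact (differentiable_pt_lim_comp _ _ _ _ _ _ _ _ _ _ _ A (Dcos s t) (Dsin s t)).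
Qed.

(** The mean of [Re q] over a circle around 0 does not depend on the radius; it
    is close to [Re A] on small circles and to [Re B] on large ones. *)
Lemma limits_agree_Re (q q' : C -> C) (A B : C) :
  (forall z, z <> RtoC 0 -> C_derive_at q z (q' z)) ->
  (forall eps, 0 < eps -> exists d, 0 < d /\
     forall z, z <> RtoC 0 -> Cmod z < d -> Cmod (q z - A) <= eps) ->
  (forall eps, 0 < eps -> exists M, forall z, M < Cmod z -> Cmod (q z - B) <= eps) ->
  fst A = fst B.
Proof.
  intros Hq HA HB.
  destruct (Req_dec (fst A) (fst B)) as [E | N]; [exact E | exfalso].
  set (e := Rabs (fst B - fst A)).
  assert (He : 0 < e) by (apply Rabs_pos_lt; lra).
  (* Two errors of [e / 3] cannot fill the gap [e] between the two means. *)
  destruct (HA (e / 3) ltac:(lra)) as (d & Hd & Ha).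
  destruct (HB (e / 3) ltac:(lra)) as (M & Hb).
  set (d' := Rmin d 1). set (M' := Rmax M 1).
  assert (Hd' : 0 < d' <= 1) by (split; [apply Rmin_glb_lt; lra | apply Rmin_r]).
  assert (HM' : 1 <= M') by apply Rmax_r.
  set (a := ln (d' / 2)). set (b := ln (M' + 1)).
  assert (Ea : exp a = d' / 2) by (apply exp_ln; lra).
  assert (Eb : exp b = M' + 1) by (apply exp_ln; lra).
  assert (Hab : a <= b) by (apply Rlt_le, ln_increasing; lra).
  assert (I := circle_integral_constant q q' Hq a b Hab).
  assert (Cq : forall s t, continuous (fun t => fst (q (polar s t))) t).
  { intros s t.
    destruct (C_derive_at_real q _ _ _ (Hq (polar s t) (polar_neq_0 s t))) as [D _].
    apply (ex_derive_continuous (K := R_AbsRing) (V := R_NormedModule)).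
    eexists. apply is_derive_Reals.
    apply (derivable_pt_lim_comp_2d (fun x y => fst (q (x, y)))
             (fun t => exp s * cos t) (fun t => exp s * sin t) t _ _
             (exp s * - sin t) (exp s * cos t) D).
    - apply is_derive_Reals. auto_derive; [trivial | ring].
    - apply is_derive_Reals. auto_derive; [trivial | ring]. }
  assert (HPI := PI_RGT_0).
  assert (K := RInt_near_const
    (fun t => fst (q (polar b t)) - fst (q (polar a t))) 0 (2 * PI)
    (fst B - fst A) (2 * e / 3)).
  rewrite I in K. lapply K; [clear K; intros K | lra].
  lapply K; [clear K; intros K |].
  2: { intros x. apply (continuous_minus (V := R_NormedModule)); apply Cq. }
  lapply K; [clear K; intros K |].
  - replace (0 - (fst B - fst A) * (2 * PI - 0))
      with ((fst B - fst A) * (- (2 * PI))) in K by ring.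
    rewrite Rabs_mult, Rabs_Ropp, (Rabs_pos_eq (2 * PI)) in K by lra.
    fold e in K. nra.
  - intros t _.
    assert (H1 := Ha (polar a t) (polar_neq_0 a t)).
    rewrite Cmod_polar, Ea in H1.
    assert (d' <= d) by apply Rmin_l. specialize (H1 ltac:(lra)).
    assert (H2 := Hb (polar b t)). rewrite Cmod_polar, Eb in H2.
    assert (M <= M') by apply Rmax_l. specialize (H2 ltac:(lra)).
    apply (Rle_trans _ _ _ (re_le_Cmod _)) in H1.
    apply (Rle_trans _ _ _ (re_le_Cmod _)) in H2.
    unfold Re in H1, H2. simpl in H1, H2.
    apply Rabs_le_between in H1. apply Rabs_le_between in H2.
    apply Rabs_le. lra.
Qed.

Lemma limits_agree (q q' : C -> C) (A B : C) :
  (forall z, z <> RtoC 0 -> C_derive_at q z (q' z)) ->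
  (forall eps, 0 < eps -> exists d, 0 < d /\
     forall z, z <> RtoC 0 -> Cmod z < d -> Cmod (q z - A) <= eps) ->
  (forall eps, 0 < eps -> exists M, forall z, M < Cmod z -> Cmod (q z - B) <= eps) ->
  A = B.
Proof.
  intros Hq HA HB.
  assert (E1 := limits_agree_Re q q' A B Hq HA HB).
  (* The imaginary part of [q] is minus the real part of [i q]. *)
  assert (E2 : fst (Ci * A)%C = fst (Ci * B)%C).
  { apply (limits_agree_Re (fun z => Ci * q z)%C (fun z => Ci * q' z)%C).
    - intros z Hz.
      replace (Ci * q' z)%C with (RtoC 0 * q z + Ci * q' z)%C by ring.
      apply (C_derive_at_mult (fun _ => Ci) q); [apply C_derive_at_const | auto].
    - intros eps He. destruct (HA eps He) as (d & Hd & H). exists d.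
      split; [exact Hd |]. intros z Hz Hlt.
      replace (Ci * q z - Ci * A)%C with (Ci * (q z - A))%C by ring.
      rewrite Cmod_mult, Cmod_Ci, Rmult_1_l. auto.
    - intros eps He. destruct (HB eps He) as (M & H). exists M. intros z Hlt.
      replace (Ci * q z - Ci * B)%C with (Ci * (q z - B))%C by ring.
      rewrite Cmod_mult, Cmod_Ci, Rmult_1_l. auto. }
  simpl in E2. destruct A, B; simpl in *. f_equal; lra.
Qed.

Lemma C_derive_zero_constant (f : C -> C) :
  (forall z, C_derive_at f z (RtoC 0)) -> forall z, f z = f (RtoC 0).
Proof.
  intros Hf [x y].
  assert (K : forall p : C -> R, 
     (forall a b, differentiable_pt_lim (fun s t => p (f (s, t))) a b 0 0) ->
     p (f (RtoC 0)) = p (f (x, y))).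
  { intros p Hp.
    assert (E := eq_is_derive (V := R_NormedModule)
                   (fun t : R => p (f (t * x, t * y))) 0 1).
    cbv beta in E. rewrite !Rmult_0_l, !Rmult_1_l in E. apply E; [| lra].
    intros t _. apply is_derive_Reals.
    replace (@zero R_NormedModule) with (0 * x + 0 * y) by (unfold zero; simpl; ring).
    apply (derivable_pt_lim_comp_2d (fun s t => p (f (s, t)))
             (fun t => t * x) (fun t => t * y)); [apply Hp | |];
      apply is_derive_Reals; auto_derive; (trivial || ring). }
  apply injective_projections; symmetry; apply K; intros a b;
    destruct (C_derive_at_real f a b _ (Hf (a, b))) as [H1 H2]; simpl in H1, H2.
  - replace (-0) with 0 in H1 by ring. exact H1.
  - exact H2.
Qed.

(** By [limits_agree], applied to the difference quotient of [f] based at an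
    arbitrary point, [f'] is the constant [L]. *)
Theorem entire_linear_growth (f f' : C -> C) (L : C) :
  (forall z, C_derive_at f z (f' z)) ->
  (forall eps, 0 < eps -> exists M, forall z, M < Cmod z ->
     Cmod (f z - L * z) <= eps * Cmod z) ->
  forall z, f z = (L * z + f (RtoC 0))%C.
Proof.
  intros Hf HL.
  assert (E : forall z0, f' z0 = L).
  { intros z0.
    assert (Hadd : forall z, C_derive_at (fun w => z0 + w)%C z (RtoC 1)).
    { intros z. replace (RtoC 1) with (RtoC 0 + RtoC 1)%C by ring.
      apply (C_derive_at_plus (fun _ => z0) (fun w => w));
        [apply C_derive_at_const | apply C_derive_at_id]. }
    apply (limits_agree (fun z => (f (z0 + z) + - f z0) / z)%C
             (fun z => ((f' (z0 + z) * 1 + 0) * z - (f (z0 + z) + - f z0) * 1) / (z * z))%C).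
    - intros z Hz.
      apply (C_derive_at_quotient (fun z => f (z0 + z) + - f z0)%C (fun z => z));
        [| apply C_derive_at_id | exact Hz].
      apply (C_derive_at_plus (fun z => f (z0 + z))%C (fun _ => - f z0)%C);
        [| apply C_derive_at_const].
      apply (C_derive_at_comp f (fun z => z0 + z)%C); [apply Hf | apply Hadd].
    - intros eps Heps.
      destruct (proj1 (C_derive_at_eps _ _ _) (Hf z0) eps Heps) as (d & Hd & H).
      exists d. split; [exact Hd |]. intros z Hz Hlt.
      specialize (H (z0 + z)%C). replace (z0 + z - z0)%C with z in H by ring.
      specialize (H Hlt).
      replace ((f (z0 + z) + - f z0) / z - f' z0)%C
        with ((f (z0 + z) - f z0 - f' z0 * z) / z)%C by (field; exact Hz).
      rewrite Cmod_div by exact Hz. apply Rle_div_l; [| exact H].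
      apply Cmod_gt_0, Hz.
    - intros eps Heps.
      destruct (HL (eps / 3) ltac:(lra)) as (M & H).
      set (c := Cmod (L * z0 - f z0)).
      assert (Hc : 0 <= c) by apply Cmod_ge_0.
      assert (H0 : 0 <= Cmod z0) by apply Cmod_ge_0.
      exists (Rmax 0 M + Cmod z0 + 3 * c / eps). intros z Hz.
      assert (M <= Rmax 0 M) by apply Rmax_r.
      assert (0 <= Rmax 0 M) by apply Rmax_l.
      assert (0 <= 3 * c / eps) by (apply Rdiv_le_0_compat; lra).
      assert (Hz0 : z <> RtoC 0) by (apply Cmod_gt_0; lra).
      assert (T1 := Cmod_triangle (z0 + z) (- z0)).
      replace (z0 + z + - z0)%C with z in T1 by ring. rewrite Cmod_opp in T1.
      assert (T2 := Cmod_triangle z0 z).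
      specialize (H (z0 + z)%C ltac:(lra)).
      replace ((f (z0 + z) + - f z0) / z - L)%C
        with ((f (z0 + z) - L * (z0 + z) + (L * z0 - f z0)) / z)%C
        by (field; exact Hz0).
      rewrite Cmod_div by exact Hz0. apply Rle_div_l; [apply Cmod_gt_0, Hz0 |].
      eapply Rle_trans; [apply Cmod_triangle |]. fold c.
      assert (Hce : c <= eps / 3 * Cmod z).
      { assert (B : 3 * c / eps <= Cmod z) by lra.
        apply (Rmult_le_compat_l (eps / 3)) in B; [| lra].
        replace (eps / 3 * (3 * c / eps)) with c in B by (field; lra). exact B. }
      nra. }
  assert (D : forall z, C_derive_at (fun z => f z + - L * z)%C z (RtoC 0)).
  { intros z. replace (RtoC 0) with (f' z + (RtoC 0 * z + - L * RtoC 1))%C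
      by (rewrite E; ring).
    apply (C_derive_at_plus f (fun z => - L * z)%C); [apply Hf |].
    apply (C_derive_at_mult (fun _ => - L)%C (fun z => z));
      [apply C_derive_at_const | apply C_derive_at_id]. }
  intros z. assert (K := C_derive_zero_constant _ D z). simpl in K.
  replace (f z) with (f z + - L * z + L * z)%C by ring. rewrite K. ring.
Qed.

(** * Charts of the sphere, holomorphic maps and pullbacks *)

(** With this convention the coordinate expression of a Moebius transformation
    is one quotient, valid at all points ([in_charts_moebius]). *)
Lemma Cinv_0 : Cinv (RtoC 0) = RtoC 0.
Proof.
  unfold Cinv, RtoC; simpl. f_equal; unfold Rdiv; ring.
Qed.

Lemma Ceq_dec (z w : C) : {z = w} + {z <> w}.
Proof. apply excluded_middle_informative. Qed.

Lemma param_CU_0 : param CU (RtoC 0) = Inf.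
Proof.
  simpl. destruct (Req_EM_T (Cmod 0) 0) as [_ | N]; [reflexivity |].
  destruct N. apply Cmod_0.
Qed.

Lemma param_CU_neq (u : C) : u <> RtoC 0 -> param CU u = Fin (Cinv u).
Proof.
  intros Hu. simpl. destruct (Req_EM_T (Cmod u) 0) as [E | _]; [| reflexivity].
  destruct Hu. apply Cmod_eq_0, E.
Qed.

Lemma Cinv_inv (z : C) : Cinv (Cinv z) = z.
Proof.
  destruct (Ceq_dec z (RtoC 0)) as [-> | N].
  - rewrite !Cinv_0. reflexivity.
  - field. exact N.
Qed.

Lemma Cinv_neq_0 (z : C) : z <> RtoC 0 -> Cinv z <> RtoC 0.
Proof. intros Hz E. apply Hz. rewrite <- (Cinv_inv z), E. apply Cinv_0. Qed.

Lemma Fin_inj (z w : C) : Fin z = Fin w -> z = w.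
Proof. exact (f_equal (coord CZ) (x := Fin z) (y := Fin w)). Qed.

Lemma coord_param (c : chart) (x : C) : coord c (param c x) = x.
Proof.
  destruct c; [reflexivity |].
  destruct (Ceq_dec x (RtoC 0)) as [-> | N].
  - rewrite param_CU_0. reflexivity.
  - rewrite param_CU_neq by exact N. apply Cinv_inv.
Qed.

Lemma in_dom_param (c : chart) (x : C) : in_dom c (param c x).
Proof.
  destruct c; [discriminate |]. intros E.
  destruct (Ceq_dec x (RtoC 0)) as [-> | N].
  - rewrite param_CU_0 in E. discriminate.
  - rewrite param_CU_neq in E by exact N. apply Fin_inj in E.
    exact (Cinv_neq_0 x N E).
Qed.

Lemma param_coord (c : chart) (p : Chat) : in_dom c p -> param c (coord c p) = p.
Proof.
  destruct c, p as [z |]; intros H; try reflexivity.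
  - destruct H. reflexivity.
  - change (param CU (Cinv z) = Fin z).
    rewrite param_CU_neq, Cinv_inv; [reflexivity |].
    apply Cinv_neq_0. intros ->. apply H. reflexivity.
  - apply param_CU_0.
Qed.

Lemma in_dom_chart_at (p : Chat) : in_dom (chart_at p) p.
Proof. destruct p; discriminate. Qed.

Lemma holomorphic_derive (h : Chat -> Chat) (c d : chart) (x : C) :
  holomorphic h -> in_dom d (h (param c x)) ->
  C_derive_at (in_charts c d h) x (C_derive (in_charts c d h) x).
Proof.
  intros Hh Hd. destruct (Hh c d x Hd) as [_ [l Hl]].
  rewrite (C_derive_at_unique _ _ _ Hl). exact Hl.
Qed.

Lemma in_charts_comp (h k : Chat -> Chat) (c d e : chart) (x : C) :
  in_dom d (h (param c x)) ->
  in_charts d e k (in_charts c d h x) = in_charts c e (fun p => k (h p)) x.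
Proof.
  intros Hd. unfold in_charts. rewrite param_coord by exact Hd. reflexivity.
Qed.

(** Near [x] the coordinate expression of the composite is the composite of the
    coordinate expressions, through any chart [d] that contains the
    intermediate point. *)
Lemma chain_rule (h k : Chat -> Chat) (c d e : chart) (x : C) :
  holomorphic h -> holomorphic k ->
  in_dom d (h (param c x)) -> in_dom e (k (h (param c x))) ->
  C_derive_at (in_charts c e (fun p => k (h p))) x
    (C_derive (in_charts d e k) (in_charts c d h x) *
     C_derive (in_charts c d h) x)%C.
Proof.
  intros Hh Hk Hd He.
  apply (C_derive_at_near (fun y => in_charts d e k (in_charts c d h y))).
  - apply (filter_imp (F := locally (T := C_UniformSpace) x)
             (fun y => in_dom d (h (param c y)))); [| apply (Hh c d x Hd)].
    intros y Hy. apply in_charts_comp, Hy.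
  - apply C_derive_at_comp; apply holomorphic_derive; try assumption.
    unfold in_charts. rewrite param_coord by exact Hd. exact He.
Qed.

Lemma holomorphic_comp (h k : Chat -> Chat) :
  holomorphic h -> holomorphic k -> holomorphic (fun p => k (h p)).
Proof.
  intros Hh Hk c e x He.
  set (d := chart_at (h (param c x))).
  assert (Hd : in_dom d (h (param c x))) by apply in_dom_chart_at.
  split; [| eexists; apply (chain_rule h k c d e x Hh Hk Hd He)].
  assert (He' : in_dom e (k (param d (in_charts c d h x))))
    by (unfold in_charts; rewrite param_coord by exact Hd; exact He).
  destruct (Hk d e (in_charts c d h x) He') as [N _].
  apply C_near in N. destruct N as (r & Hr & N).
  destruct (C_derive_at_continuous _ _ _ (holomorphic_derive h c d x Hh Hd) r Hr)
    as (s & Hs & K).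
  destruct (Hh c d x Hd) as [M _].
  assert (K' : locally (T := C_UniformSpace) x (fun y =>
            Cmod (in_charts c d h y - in_charts c d h x) < r))
    by (apply C_near; eauto).
  generalize (filter_and (F := locally (T := C_UniformSpace) x) _ _ M K').
  apply filter_imp. intros y [Hy1 Hy2]. specialize (N _ Hy2).
  unfold in_charts in N. rewrite param_coord in N by exact Hy1. exact N.
Qed.

(** Both sides read the composite in the chart [chart_at] of the final point,
    so this is the chain rule at that chart. *)
Lemma pullback_comp (h k : Chat -> Chat) (g : tensor) :
  holomorphic h -> holomorphic k ->
  pullback h (pullback k g) = pullback (fun p => k (h p)) g.
Proof.
  intros Hh Hk.
  do 4 (apply functional_extensionality; intro). rename x into c, x0 into x, x1 into v, x2 into w.
  unfold pullback.
  set (d := chart_at (h (param c x))).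
  assert (Hd : in_dom d (h (param c x))) by apply in_dom_chart_at.
  replace (param d (in_charts c d h x)) with (h (param c x))
    by (symmetry; apply param_coord, Hd).
  set (e := chart_at (k (h (param c x)))).
  assert (He : in_dom e (k (h (param c x)))) by apply in_dom_chart_at.
  rewrite (in_charts_comp h k c d e x Hd).
  rewrite (C_derive_at_unique _ _ _ (chain_rule h k c d e x Hh Hk Hd He)).
  rewrite !Cmult_assoc. reflexivity.
Qed.

(** * Moebius transformations *)

(** The point with homogeneous coordinates [p : q]. *)
Definition proj (p q : C) : Chat :=
  if Ceq_dec q (RtoC 0) then Inf else Fin (p / q).

Definition moebius (a b c d : C) (P : Chat) : Chat :=
  match P with
  | Fin z => proj (a * z + b) (c * z + d)
  | Inf => proj a c
  end.

Lemma proj_0 (p : C) : proj p (RtoC 0) = Inf.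
Proof. unfold proj. destruct Ceq_dec; tauto. Qed.

Lemma proj_neq_0 (p q : C) : q <> RtoC 0 -> proj p q = Fin (p / q).
Proof. intros H. unfold proj. destruct Ceq_dec; tauto. Qed.

Lemma proj_scale (s p q : C) :
  s <> RtoC 0 -> proj (s * p) (s * q) = proj p q.
Proof.
  intros Hs. destruct (Ceq_dec q (RtoC 0)) as [-> | N].
  - rewrite Cmult_0_r, !proj_0. reflexivity.
  - rewrite !proj_neq_0; [f_equal; field; auto | exact N |].
    apply Cmult_neq_0; assumption.
Qed.

Lemma coord_proj (p q : C) :
  coord CZ (proj p q) = (p / q)%C /\ coord CU (proj p q) = (q / p)%C.
Proof.
  unfold Cdiv. destruct (Ceq_dec q (RtoC 0)) as [-> | N].
  - rewrite proj_0, Cinv_0, Cmult_0_r, Cmult_0_l. split; reflexivity.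
  - rewrite proj_neq_0 by exact N. split; [reflexivity |]. simpl.
    destruct (Ceq_dec p (RtoC 0)) as [-> | M].
    + unfold Cdiv. rewrite Cmult_0_l, Cinv_0, Cmult_0_r. reflexivity.
    + field. auto.
Qed.

Lemma in_dom_proj (p q : C) :
  (p <> RtoC 0 \/ q <> RtoC 0) ->
  (in_dom CZ (proj p q) <-> q <> RtoC 0) /\
  (in_dom CU (proj p q) <-> p <> RtoC 0).
Proof.
  intros H. destruct (Ceq_dec q (RtoC 0)) as [-> | N].
  - rewrite proj_0. simpl. split; split; intros K; try tauto. discriminate.
  - rewrite proj_neq_0 by exact N. simpl. split; split; intros K; try tauto.
    + discriminate.
    + intros ->. apply K. f_equal. unfold Cdiv. apply Cmult_0_l.
    + intros E. apply Fin_inj in E. apply K.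
      replace p with (p / q * q)%C by (field; exact N). rewrite E. apply Cmult_0_l.
Qed.

(** The form (a, b) applied to the homogeneous coordinates (x, 1) or (1, x) of
    the point [param s x], according to the chart [s]. *)
Definition row_form (s : chart) (a b x : C) : C :=
  match s with CZ => a * x + b | CU => b * x + a end.

Lemma moebius_param (a b c d : C) (s : chart) (x : C) :
  moebius a b c d (param s x) = proj (row_form s a b x) (row_form s c d x).
Proof.
  destruct s; [reflexivity |].
  destruct (Ceq_dec x (RtoC 0)) as [-> | N].
  - rewrite param_CU_0. simpl. f_equal; ring.
  - rewrite param_CU_neq by exact N. simpl.
    rewrite <- (proj_scale x) by exact N. f_equal; field; exact N.
Qed.

Lemma row_forms_not_both_zero (a b c d : C) (s : chart) (x : C) :
  (a * d - b * c)%C <> RtoC 0 ->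
  row_form s a b x <> RtoC 0 \/ row_form s c d x <> RtoC 0.
Proof.
  intros Hdet. destruct (Ceq_dec (row_form s a b x) (RtoC 0)) as [E1 |]; [| auto].
  destruct (Ceq_dec (row_form s c d x) (RtoC 0)) as [E2 |]; [| auto].
  destruct Hdet. destruct s; simpl in E1, E2.
  - assert (Ea : (b = - (a * x))%C) by (rewrite <- (Cplus_0_r (- _)), <- E1; ring).
    assert (Ec : (d = - (c * x))%C) by (rewrite <- (Cplus_0_r (- _)), <- E2; ring).
    rewrite Ea, Ec. ring.
  - assert (Ea : (a = - (b * x))%C) by (rewrite <- (Cplus_0_r (- _)), <- E1; ring).
    assert (Ec : (c = - (d * x))%C) by (rewrite <- (Cplus_0_r (- _)), <- E2; ring).
    rewrite Ea, Ec. ring.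
Qed.

Lemma row_form_derive (s : chart) (a b x : C) :
  C_derive_at (row_form s a b) x (match s with CZ => a | CU => b end).
Proof.
  assert (K : forall a b, C_derive_at (fun x => a * x + b)%C x a).
  { clear a b; intros a b.
    assert (E := C_derive_at_plus _ _ x _ _
       (C_derive_at_mult _ _ x _ _ (C_derive_at_const a x) (C_derive_at_id x))
       (C_derive_at_const b x)).
    cbv beta in E. replace (RtoC 0 * x + a * RtoC 1 + RtoC 0)%C with a in E by ring. exact E. }
  destruct s; apply K.
Qed.

(** The coordinate in the chart [t] of the point [p : q] is
    [num t p q / den t p q]. *)
Definition num (t : chart) (p q : C) : C := match t with CZ => p | CU => q end.
Definition den (t : chart) (p q : C) : C := match t with CZ => q | CU => p end.

Lemma in_charts_moebius (a b c d : C) (s t : chart) (x : C) :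
  in_charts s t (moebius a b c d) x =
  (num t (row_form s a b x) (row_form s c d x) /
   den t (row_form s a b x) (row_form s c d x))%C.
Proof.
  unfold in_charts. rewrite moebius_param.
  destruct t; simpl num; simpl den; apply coord_proj.
Qed.

Lemma in_dom_moebius (a b c d : C) (s t : chart) (x : C) :
  (a * d - b * c)%C <> RtoC 0 ->
  in_dom t (moebius a b c d (param s x)) <->
  den t (row_form s a b x) (row_form s c d x) <> RtoC 0.
Proof.
  intros Hdet. rewrite moebius_param.
  destruct t; apply in_dom_proj, row_forms_not_both_zero, Hdet.
Qed.

(** The sign depends on the charts: exchanging [z] and [1/z] at the source or
    at the target changes the sign of the determinant. *)
Lemma moebius_derive (a b c d : C) (s t : chart) (x : C) :
  (a * d - b * c)%C <> RtoC 0 ->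
  in_dom t (moebius a b c d (param s x)) ->
  exists e, (e = a * d - b * c \/ e = - (a * d - b * c))%C /\
    C_derive_at (in_charts s t (moebius a b c d)) x
      (e / (den t (row_form s a b x) (row_form s c d x) *
            den t (row_form s a b x) (row_form s c d x)))%C.
Proof.
  intros Hdet Hd. apply in_dom_moebius in Hd; [| exact Hdet].
  assert (K : forall f1 f2 l1 l2,
    C_derive_at f1 x l1 -> C_derive_at f2 x l2 -> f2 x <> RtoC 0 ->
    (forall y, in_charts s t (moebius a b c d) y = f1 y / f2 y)%C ->
    C_derive_at (in_charts s t (moebius a b c d)) x
      ((l1 * f2 x - f1 x * l2) / (f2 x * f2 x))%C).
  { intros f1 f2 l1 l2 H1 H2 H3 H4.
    apply (C_derive_at_ext (fun y => f1 y / f2 y)%C); [intros; symmetry; apply H4 |].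
    apply C_derive_at_quotient; assumption. }
  assert (Hr := in_charts_moebius a b c d s t).
  destruct t; simpl num in *; simpl den in *;
    assert (K' := K _ _ _ _ (row_form_derive s _ _ x) (row_form_derive s _ _ x) Hd Hr);
    eexists; (split; [| exact K']); destruct s; simpl; 
    solve [left; ring | right; ring].
Qed.

Lemma holomorphic_moebius (a b c d : C) :
  (a * d - b * c)%C <> RtoC 0 -> holomorphic (moebius a b c d).
Proof.
  intros Hdet s t x Hd. split.
  - assert (Hd' := Hd). apply in_dom_moebius in Hd'; [| exact Hdet].
    apply (filter_imp (F := locally (T := C_UniformSpace) x) (fun y =>
       den t (row_form s a b y) (row_form s c d y) <> RtoC 0)).
    { intros y Hy. apply in_dom_moebius; assumption. }
    destruct t; simpl in *;
      exact (C_derive_at_near_neq _ _ _ _ (row_form_derive s _ _ x) Hd').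
  - destruct (moebius_derive a b c d s t x Hdet Hd) as (e & _ & K).
    eexists. exact K.
Qed.

Lemma moebius_proj (a b c d p q : C) :
  (p <> RtoC 0 \/ q <> RtoC 0) ->
  moebius a b c d (proj p q) = proj (a * p + b * q) (c * p + d * q).
Proof.
  intros H. destruct (Ceq_dec q (RtoC 0)) as [-> | N].
  - rewrite proj_0. destruct H as [H | H]; [| tauto].
    simpl. rewrite <- (proj_scale p) by exact H. f_equal; ring.
  - rewrite proj_neq_0 by exact N. simpl.
    rewrite <- (proj_scale q) by exact N. f_equal; field; exact N.
Qed.

Lemma moebius_comp (a b c d a' b' c' d' : C) (P : Chat) :
  (a' * d' - b' * c')%C <> RtoC 0 ->
  moebius a b c d (moebius a' b' c' d' P) =
  moebius (a * a' + b * c') (a * b' + b * d') (c * a' + d * c') (c * b' + d * d') P.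
Proof.
  intros Hdet.
  set (s := chart_at P).
  rewrite <- (param_coord s P) by apply in_dom_chart_at.
  rewrite !moebius_param.
  rewrite moebius_proj by (apply row_forms_not_both_zero, Hdet).
  destruct s; simpl; f_equal; ring.
Qed.

(** * Every automorphism of the sphere is a Moebius transformation *)

Lemma moebius_id (P : Chat) : moebius 1 0 0 1 P = P.
Proof.
  destruct P as [z |]; simpl; [| apply proj_0].
  replace (0 * z + 1)%C with (RtoC 1) by ring.
  rewrite proj_neq_0 by apply C1_nz. f_equal. field.
Qed.

Lemma biholomorphism_derive_neq_0 (h k : Chat -> Chat) (c d : chart) (x : C) :
  holomorphic h -> holomorphic k -> (forall p, k (h p) = p) ->
  in_dom d (h (param c x)) -> C_derive (in_charts c d h) x <> RtoC 0.
Proof.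
  intros Hh Hk Hkh Hd E.
  assert (He : in_dom c (k (h (param c x)))) by (rewrite Hkh; apply in_dom_param).
  assert (K := chain_rule h k c d c x Hh Hk Hd He).
  rewrite E, Cmult_0_r in K.
  apply C1_nz. apply (C_derive_at_inj (fun y => y) x); [apply C_derive_at_id |].
  revert K. apply C_derive_at_ext. intros w. unfold in_charts.
  rewrite Hkh. apply coord_param.
Qed.

(** In the coordinate [u = 1/z] at both ends the automorphism is a function [H]
    with [H 0 = 0] and [H' 0 = a <> 0].  Hence [f z = 1 / H (1/z)] satisfies
    [f z / z -> 1 / a] at infinity, and [entire_linear_growth] applies. *)
Lemma aut_fixing_Inf (h k : Chat -> Chat) :
  holomorphic h -> holomorphic k -> inverse_maps h k -> h Inf = Inf ->
  exists L b, L <> RtoC 0 /\ forall P, h P = moebius L b 0 1 P.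
Proof.
  intros Hh Hk [Hhk Hkh] HI.
  set (f := in_charts CZ CZ h). set (H := in_charts CU CU h).
  assert (Hfin : forall z, in_dom CZ (h (param CZ z))).
  { intros z. simpl. rewrite <- HI. intros E.
    apply (f_equal k) in E. rewrite !Hkh in E. discriminate. }
  assert (Hf : forall z, C_derive_at f z (C_derive f z)).
  { intros z. apply holomorphic_derive; [exact Hh | apply Hfin]. }
  assert (H0 : in_dom CU (h (param CU (RtoC 0)))).
  { rewrite param_CU_0, HI. discriminate. }
  set (a := C_derive H (RtoC 0)).
  assert (Ha : C_derive_at H (RtoC 0) a) by (apply holomorphic_derive; assumption).
  assert (Ha0 : a <> RtoC 0) by exact (biholomorphism_derive_neq_0 h k CU CU 0 Hh Hk Hkh H0).
  assert (EH : H (RtoC 0) = RtoC 0).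
  { unfold H, in_charts. rewrite param_CU_0, HI. reflexivity. }
  assert (Hfz : forall z, h (Fin z) = Fin (f z)).
  { intros z. symmetry. apply (param_coord CZ), Hfin. }
  assert (EfH : forall z, z <> RtoC 0 -> f z = Cinv (H (Cinv z))).
  { intros z Hz. unfold H, in_charts.
    rewrite param_CU_neq, Cinv_inv, Hfz by (apply Cinv_neq_0, Hz).
    simpl. symmetry. apply Cinv_inv. }
  assert (Hm : 0 < Cmod a) by (apply Cmod_gt_0, Ha0).
  assert (Hlin := entire_linear_growth f (C_derive f) (Cinv a) Hf).
  lapply Hlin; clear Hlin.
  - intros Hlin. exists (Cinv a), (f (RtoC 0)).
    split; [apply Cinv_neq_0, Ha0 |].
    intros [z |]; simpl.
    + replace (0 * z + 1)%C with (RtoC 1) by ring.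
      rewrite proj_neq_0 by apply C1_nz. rewrite Hfz, Hlin. f_equal. field. exact Ha0.
    + rewrite proj_0. exact HI.
  - intros eps Heps.
    (* The first bound gives [|H u| >= |a| |u| / 2]; then
       [1 / H u - 1 / (a u) = (a u - H u) / (a u H u)] has modulus at most
       [2 eta / (|a| ^ 2 |u|)], and the second bound makes this at most
       [eps / |u|]. *)
    set (eta := Rmin (Cmod a / 2) (eps * Cmod a ^ 2 / 2)).
    assert (Heta : 0 < eta).
    { apply Rmin_glb_lt; [lra |]. assert (0 < Cmod a ^ 2) by (apply pow_lt, Hm). nra. }
    assert (He1 : eta <= Cmod a / 2) by apply Rmin_l.
    assert (He2 : eta <= eps * Cmod a ^ 2 / 2) by apply Rmin_r.
    destruct (proj1 (C_derive_at_eps _ _ _) Ha eta Heta) as (d & Hd & Hw).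
    exists (/ d). intros z Hz.
    assert (Hd' : 0 < / d) by (apply Rinv_0_lt_compat, Hd).
    assert (Hz0 : z <> RtoC 0) by (apply Cmod_gt_0; lra).
    set (u := Cinv z).
    assert (Hu0 : u <> RtoC 0) by (apply Cinv_neq_0, Hz0).
    assert (Mu : Cmod u = / Cmod z) by (apply Cmod_inv, Hz0).
    assert (Hup : 0 < Cmod u) by (apply Cmod_gt_0, Hu0).
    specialize (Hw u). rewrite EH in Hw.
    replace (u - 0)%C with u in Hw by ring.
    replace (H u - 0 - a * u)%C with (H u - a * u)%C in Hw by ring.
    lapply Hw; [clear Hw; intros Hw |].
    2: { rewrite Mu. rewrite <- (Rinv_inv d). apply Rinv_lt_contravar; [| exact Hz].
         apply Rmult_lt_0_compat; lra. }
    assert (HHu : Cmod a / 2 * Cmod u <= Cmod (H u)).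
    { assert (T := Cmod_triangle (H u) (- (H u - a * u))).
      replace (H u + - (H u - a * u))%C with (a * u)%C in T by ring.
      rewrite Cmod_opp, Cmod_mult in T. nra. }
    assert (HH0 : H u <> RtoC 0) by (apply Cmod_gt_0; nra).
    rewrite EfH by exact Hz0. fold u.
    replace (/ H u - / a * z)%C with (- ((H u - a * u) / (a * u * H u)))%C.
    2: { replace z with (/ u)%C by apply Cinv_inv. field. auto. }
    rewrite Cmod_opp, Cmod_div by (apply Cmult_neq_0; [apply Cmult_neq_0 |]; assumption).
    rewrite !Cmod_mult.
    assert (Mz : Cmod z = / Cmod u) by (rewrite Mu, Rinv_inv; reflexivity).
    rewrite Mz.
    apply Rle_div_l.
    { repeat apply Rmult_lt_0_compat; try assumption. apply Cmod_gt_0, HH0. }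
    eapply Rle_trans; [exact Hw |].
    replace (eps * / Cmod u * (Cmod a * Cmod u * Cmod (H u)))
      with (eps * Cmod a * Cmod (H u)) by (field; lra).
    apply Rle_trans with (eps * Cmod a * (Cmod a / 2 * Cmod u)); [nra |].
    apply Rmult_le_compat_l; [nra | exact HHu].
Qed.

Theorem aut_is_moebius (h : Chat -> Chat) :
  Aut h ->
  exists a b c d, (a * d - b * c)%C <> RtoC 0 /\ h = moebius a b c d.
Proof.
  intros (Hh & k & Hk & Hhk & Hkh).
  destruct (h Inf) as [w |] eqn:E.
  - assert (N1 : (0 * - w - 1 * 1)%C <> RtoC 0).
    { replace (0 * - w - 1 * 1)%C with (- (1))%C by ring.
      intros K. apply C1_nz. replace (RtoC 1) with (- - (1))%C by ring. rewrite K. ring. }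
    assert (N2 : (w * 0 - 1 * 1)%C <> RtoC 0).
    { replace (w * 0 - 1 * 1)%C with (0 * - w - 1 * 1)%C by ring. exact N1. }
    (* [s] is [1 / (z - w)], which sends [h Inf = Fin w] to infinity; [s'] is its
       inverse [w + 1 / z]. *)
    set (s := moebius 0 1 1 (- w)). set (s' := moebius w 1 1 0).
    assert (Ess : forall P, s (s' P) = P).
    { intros P. unfold s, s'. rewrite moebius_comp by exact N2.
      rewrite <- (moebius_id P) at 2. f_equal; ring. }
    assert (Ess' : forall P, s' (s P) = P).
    { intros P. unfold s, s'. rewrite moebius_comp by exact N1.
      rewrite <- (moebius_id P) at 2. f_equal; ring. }
    assert (Hs : holomorphic s) by (apply holomorphic_moebius, N1).
    assert (Hs' : holomorphic s') by (apply holomorphic_moebius, N2).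
    destruct (aut_fixing_Inf (fun p => s (h p)) (fun p => k (s' p)))
      as (L & b & HL & Hm).
    + apply holomorphic_comp; assumption.
    + apply holomorphic_comp; assumption.
    + split; intros P; [rewrite Hhk; apply Ess | rewrite Ess'; apply Hkh].
    + rewrite E. simpl. replace (1 * w + - w)%C with (RtoC 0) by ring. apply proj_0.
    + assert (N3 : (L * 1 - b * 0)%C <> RtoC 0).
      { replace (L * 1 - b * 0)%C with L by ring. exact HL. }
      do 4 eexists. split.
      2: { apply functional_extensionality. intros P.
           rewrite <- (Ess' (h P)), Hm. unfold s'. apply moebius_comp, N3. }
      intros K. apply HL. replace L with (- - L)%C by ring.
      match type of K with ?e = _ => replace (- L)%C with e by ring end.
      rewrite K. ring.
  - destruct (aut_fixing_Inf h k) as (L & b & HL & Hm); try assumption.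
    { split; assumption. }
    exists L, b, (RtoC 0), (RtoC 1). split.
    + replace (L * 1 - b * 0)%C with L by ring. exact HL.
    + apply functional_extensionality, Hm.
Qed.

(** * Smooth functions on the plane *)

(** For functions on the plane, the clause of [class_C] for [n + 1] does not
    literally contain the one for [n]; inductions on products need all orders
    up to [n] at once. *)
Definition smooth_upto (n : nat) (f : C -> R) : Prop :=
  forall k, (k <= n)%nat -> class_C k f.

Lemma class_C_ext (n : nat) (f g : C -> R) :
  (forall z, f z = g z) -> class_C n f -> class_C n g.
Proof. intros H. rewrite (functional_extensionality f g H). trivial. Qed.

Lemma class_C_const (n : nat) (a : R) : class_C n (fun _ => a).
Proof.
  revert a. induction n as [| n IH]; intros a; simpl.
  - intros z. apply continuous_const.
  - split; [| split].
    + intros x y. split; apply ex_derive_const.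
    + replace (fun _ : C => Derive (fun _ => a) _) with (fun _ : C => 0); [apply IH |].
      apply functional_extensionality; intros z. symmetry. apply Derive_const.
    + replace (fun _ : C => Derive (fun _ => a) _) with (fun _ : C => 0); [apply IH |].
      apply functional_extensionality; intros z. symmetry. apply Derive_const.
Qed.

Lemma class_C_fst (n : nat) : class_C n fst.
Proof.
  destruct n as [| n]; simpl.
  - intros [x y]. apply continuous_fst.
  - split; [| split].
    + intros x y. split; [apply ex_derive_id | apply ex_derive_const].
    + replace (fun z : C => Derive (fun t => t) (fst z)) with (fun _ : C => 1);
        [apply class_C_const |].
      apply functional_extensionality; intros z. symmetry. apply Derive_id.
    + replace (fun z : C => Derive (fun t => fst z) (snd z)) with (fun _ : C => 0);
        [apply class_C_const |].
      apply functional_extensionality; intros z. symmetry. apply Derive_const.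
Qed.

Lemma class_C_snd (n : nat) : class_C n snd.
Proof.
  destruct n as [| n]; simpl.
  - intros [x y]. apply continuous_snd.
  - split; [| split].
    + intros x y. split; [apply ex_derive_const | apply ex_derive_id].
    + replace (fun z : C => Derive (fun t => snd z) (fst z)) with (fun _ : C => 0);
        [apply class_C_const |].
      apply functional_extensionality; intros z. symmetry. apply Derive_const.
    + replace (fun z : C => Derive (fun t => t) (snd z)) with (fun _ : C => 1);
        [apply class_C_const |].
      apply functional_extensionality; intros z. symmetry. apply Derive_id.
Qed.

Lemma class_C_plus (n : nat) (f g : C -> R) :
  class_C n f -> class_C n g -> class_C n (fun z => f z + g z).
Proof.
  revert f g. induction n as [| n IH]; simpl; intros f g.
  - intros Hf Hg z.
    apply (continuous_plus (K := R_AbsRing) (V := R_NormedModule) f g); auto.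
  - intros (Df & Fx & Fy) (Dg & Gx & Gy). split; [| split].
    + intros x y. destruct (Df x y), (Dg x y). split.
      * apply (ex_derive_plus (fun t => f (t, y)) (fun t => g (t, y))); assumption.
      * apply (ex_derive_plus (fun t => f (x, t)) (fun t => g (x, t))); assumption.
    + assert (K := IH _ _ Fx Gx). revert K.
      apply class_C_ext. intros [x y]. symmetry. cbn [fst snd].
      apply (Derive_plus (fun t => f (t, y)) (fun t => g (t, y)));
        [apply (Df x y) | apply (Dg x y)].
    + assert (K := IH _ _ Fy Gy). revert K.
      apply class_C_ext. intros [x y]. symmetry. cbn [fst snd].
      apply (Derive_plus (fun t => f (x, t)) (fun t => g (x, t)));
        [apply (Df x y) | apply (Dg x y)].
Qed.

Lemma smooth_upto_pred (n : nat) (f : C -> R) :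
  smooth_upto (S n) f -> smooth_upto n f.
Proof. intros H k Hk. apply H. lia. Qed.

Lemma smooth_upto_partials (n : nat) (f : C -> R) :
  smooth_upto (S n) f ->
  smooth_upto n (fun z => Derive (fun t => f (t, snd z)) (fst z)) /\
  smooth_upto n (fun z => Derive (fun t => f (fst z, t)) (snd z)).
Proof. intros H. split; intros k Hk; apply (H (S k)); lia. Qed.

Lemma class_C_mult (n : nat) (f g : C -> R) :
  smooth_upto n f -> smooth_upto n g -> class_C n (fun z => f z * g z).
Proof.
  revert f g. induction n as [| n IH]; intros f g Hf Hg.
  - intros z. apply (continuous_mult (K := R_AbsRing) f g);
      [apply (Hf 0%nat) | apply (Hg 0%nat)]; lia.
  - destruct (smooth_upto_partials n f Hf) as [Fx Fy].
    destruct (smooth_upto_partials n g Hg) as [Gx Gy].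
    destruct (Hf (S n) (le_n _)) as (Df & _). destruct (Hg (S n) (le_n _)) as (Dg & _).
    apply smooth_upto_pred in Hf, Hg. split; [| split].
    + intros x y. destruct (Df x y), (Dg x y). split.
      * apply (ex_derive_mult (fun t => f (t, y)) (fun t => g (t, y))); assumption.
      * apply (ex_derive_mult (fun t => f (x, t)) (fun t => g (x, t))); assumption.
    + assert (K := class_C_plus n _ _ (IH _ _ Fx Hg) (IH _ _ Hf Gx)).
      revert K.
      apply class_C_ext. intros [x y]. symmetry. cbn [fst snd].
      apply (Derive_mult (fun t => f (t, y)) (fun t => g (t, y)));
        [apply (Df x y) | apply (Dg x y)].
    + assert (K := class_C_plus n _ _ (IH _ _ Fy Hg) (IH _ _ Hf Gy)).
      revert K.
      apply class_C_ext. intros [x y]. symmetry. cbn [fst snd].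
      apply (Derive_mult (fun t => f (x, t)) (fun t => g (x, t)));
        [apply (Df x y) | apply (Dg x y)].
Qed.

Lemma smooth_upto_mult (n : nat) (f g : C -> R) :
  smooth_upto n f -> smooth_upto n g -> smooth_upto n (fun z => f z * g z).
Proof.
  intros Hf Hg k Hk. apply class_C_mult; intros j Hj; [apply Hf | apply Hg]; lia.
Qed.

Lemma smooth_mult (f g : C -> R) :
  smooth f -> smooth g -> smooth (fun z => f z * g z).
Proof. intros Hf Hg n. apply class_C_mult; intros k _; auto. Qed.

Lemma smooth_plus (f g : C -> R) :
  smooth f -> smooth g -> smooth (fun z => f z + g z).
Proof. intros Hf Hg n. apply class_C_plus; auto. Qed.

(** The partial derivatives of [1/f] are [- f_x / f^2] and [- f_y / f^2]:
    products of smooth functions and of [1/f], which is of class C^n by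
    induction. *)
Lemma smooth_inv (f : C -> R) :
  smooth f -> (forall z, f z <> 0) -> smooth (fun z => / f z).
Proof.
  intros Hf H0.
  assert (K : forall n, smooth_upto n (fun z => / f z)).
  { induction n as [| n IH]; intros k Hk.
    - replace k with 0%nat by lia. intros z.
      apply (continuous_comp f Rinv); [apply (Hf 0%nat) |].
      apply (ex_derive_continuous (K := R_AbsRing) (V := R_NormedModule)).
      auto_derive. apply H0.
    - destruct (Nat.eq_dec k (S n)) as [-> | N]; [| apply IH; lia].
      destruct (Hf (S n)) as (Df & _).
      destruct (smooth_upto_partials n f) as [Fx Fy]; [intros j _; apply Hf |].
      assert (C1 : smooth_upto n (fun _ => -1)) by (intros j _; apply class_C_const).
      assert (IH2 := smooth_upto_mult n _ _ C1 (smooth_upto_mult n _ _ IH IH)).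
      split; [| split].
      + intros x y. destruct (Df x y). split;
          [apply (ex_derive_inv (fun t => f (t, y))) | apply (ex_derive_inv (fun t => f (x, t)))];
          auto.
      + assert (K := class_C_mult n _ _ Fx IH2). revert K.
      apply class_C_ext. intros [x y]. symmetry. cbn [fst snd].
        etransitivity; [apply (Derive_inv (fun t => f (t, y))); [apply (Df x y) | apply H0] |].
        simpl. field. apply H0.
      + assert (K := class_C_mult n _ _ Fy IH2). revert K.
      apply class_C_ext. intros [x y]. symmetry. cbn [fst snd].
        etransitivity; [apply (Derive_inv (fun t => f (x, t))); [apply (Df x y) | apply H0] |].
        simpl. field. apply H0. }
  intros n. apply (K n n (le_n n)).
Qed.

Lemma smooth_Cmod2_row_form (s : chart) (a b : C) :
  smooth (fun x => Cmod (row_form s a b x) ^ 2).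
Proof.
  assert (K : forall a b : C, smooth (fun x => Cmod (a * x + b) ^ 2)).
  { clear a b. intros a b.
    pose (re := fun x : C => fst a * fst x + (- snd a * snd x + fst b)).
    pose (im := fun x : C => fst a * snd x + (snd a * fst x + snd b)).
    assert (Hc : forall c : R, smooth (fun _ => c)) by (intros c n; apply class_C_const).
    assert (Hre : smooth re).
    { apply (smooth_plus (fun x => fst a * fst x) (fun x => - snd a * snd x + fst b)).
      - apply (smooth_mult (fun _ => fst a) fst); [apply Hc | exact class_C_fst].
      - apply (smooth_plus (fun x => - snd a * snd x) (fun _ => fst b)); [| apply Hc].
        apply (smooth_mult (fun _ => - snd a) snd); [apply Hc | exact class_C_snd]. }
    assert (Him : smooth im).
    { apply (smooth_plus (fun x => fst a * snd x) (fun x => snd a * fst x + snd b)).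
      - apply (smooth_mult (fun _ => fst a) snd); [apply Hc | exact class_C_snd].
      - apply (smooth_plus (fun x => snd a * fst x) (fun _ => snd b)); [| apply Hc].
        apply (smooth_mult (fun _ => snd a) fst); [apply Hc | exact class_C_fst]. }
    replace (fun x : C => Cmod (a * x + b) ^ 2)
      with (fun x => re x * re x + im x * im x).
    - apply smooth_plus; apply smooth_mult; assumption.
    - apply functional_extensionality. intros x. rewrite Cmod2_alt.
      unfold re, im, Re, Im. simpl. ring. }
  destruct s; apply K.
Qed.

(** * The metric pulled back by a Moebius transformation *)

Definition dotC (v w : C) : R := fst v * fst w + snd v * snd w.

(** Multiplication by [D] is a similarity of ratio [|D|]: this is why the
    pullback of a conformal metric by a holomorphic map is conformal. *)
Lemma dotC_mult (D v w : C) :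
  dotC (Cmult D v) (Cmult D w) = Cmod D ^ 2 * dotC v w.
Proof.
  unfold dotC. rewrite Cmod2_alt. destruct D, v, w; simpl. ring.
Qed.

Lemma dotC_pos (v : C) : v <> RtoC 0 -> 0 < dotC v v.
Proof.
  intros H. replace (dotC v v) with (Cmod v ^ 2).
  - apply pow_lt, Cmod_gt_0, H.
  - rewrite Cmod2_alt. unfold dotC, Re, Im. ring.
Qed.

(** With [p] and [q] the homogeneous coordinates of the image, the derivative
    has modulus [|ad - bc| / |q|^2] and the conformal factor at the image point
    [p / q] is [4 |q|^4 / (|p|^2 + |q|^2)^2]; the powers of [|q|] cancel.  The
    formula is the same in all charts because [p] and [q] play symmetric
    roles. *)
Lemma pullback_moebius (a b c d : C) :
  (a * d - b * c)%C <> RtoC 0 ->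
  pullback (moebius a b c d) g_sphere = fun s x v w =>
    4 * Cmod (a * d - b * c) ^ 2 /
      (Cmod (row_form s a b x) ^ 2 + Cmod (row_form s c d x) ^ 2) ^ 2 * dotC v w.
Proof.
  intros Hdet. do 4 (apply functional_extensionality; intro).
  rename x into s, x0 into x, x1 into v, x2 into w.
  unfold pullback, g_sphere.
  set (t := chart_at (moebius a b c d (param s x))).
  assert (Hd : in_dom t (moebius a b c d (param s x))) by apply in_dom_chart_at.
  destruct (moebius_derive a b c d s t x Hdet Hd) as (e & He & HD).
  apply in_dom_moebius in Hd; [| exact Hdet].
  rewrite (C_derive_at_unique _ _ _ HD), in_charts_moebius.
  fold (dotC v w). rewrite <- (Rmult_1_r (4 * _ / _)).
  match goal with |- context [fst (?D * v)%C * _ + _] =>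
    change (fst (D * v)%C * fst (D * w)%C + snd (D * v)%C * snd (D * w)%C)
      with (dotC (D * v) (D * w)) end.
  rewrite dotC_mult.
  assert (Ee : Cmod e = Cmod (a * d - b * c)).
  { destruct He as [-> | ->]; [| rewrite Cmod_opp]; reflexivity. }
  rewrite !Cmod_div, Cmod_mult, Ee by (try apply Cmult_neq_0; assumption).
  set (p := row_form s a b x) in *. set (q := row_form s c d x) in *.
  assert (Hpos : forall r y : R, 0 < y -> 0 < r ^ 2 + y ^ 2).
  { intros r y Hy. assert (0 <= r ^ 2) by apply pow2_ge_0.
    assert (0 < y ^ 2) by (apply pow_lt, Hy). lra. }
  apply Cmod_gt_0 in Hd.
  assert (K := Hpos (Cmod (num t p q)) _ Hd).
  destruct t; simpl num in *; simpl den in *; field; repeat split; nra.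
Qed.

Lemma row_forms_norm_pos (a b c d : C) (s : chart) (x : C) :
  (a * d - b * c)%C <> RtoC 0 ->
  0 < Cmod (row_form s a b x) ^ 2 + Cmod (row_form s c d x) ^ 2.
Proof.
  intros Hdet.
  assert (0 <= Cmod (row_form s a b x) ^ 2) by apply pow2_ge_0.
  assert (0 <= Cmod (row_form s c d x) ^ 2) by apply pow2_ge_0.
  destruct (row_forms_not_both_zero a b c d s x Hdet) as [N | N];
    apply Cmod_gt_0 in N; apply (pow_lt _ 2) in N; lra.
Qed.

Lemma riemannian_pullback_moebius (a b c d : C) :
  (a * d - b * c)%C <> RtoC 0 ->
  riemannian_metric (pullback (moebius a b c d) g_sphere).
Proof.
  intros Hdet. rewrite pullback_moebius by exact Hdet.
  assert (Hk : 0 < Cmod (a * d - b * c) ^ 2) by (apply pow_lt, Cmod_gt_0, Hdet).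
  assert (Hn := fun s x => row_forms_norm_pos a b c d s x Hdet).
  split; [| split; [| split; [| split]]].
  - intros s x t v v' w. unfold dotC. simpl. ring.
  - intros s x v w. unfold dotC. ring.
  - intros s x v Hv. apply Rmult_lt_0_compat; [| apply dotC_pos, Hv].
    apply Rdiv_lt_0_compat; [lra | apply pow_lt, Hn].
  - intros s v w.
    pose (N := fun x => Cmod (row_form s a b x) ^ 2 + Cmod (row_form s c d x) ^ 2).
    assert (HN : smooth N) by (apply smooth_plus; apply smooth_Cmod2_row_form).
    assert (HN0 : forall x, N x <> 0) by (intros x; apply Rgt_not_eq, Hn).
    assert (HI := smooth_inv N HN HN0).
    assert (K := smooth_mult (fun _ => 4 * Cmod (a * d - b * c) ^ 2 * dotC v w) _
                   (fun n => class_C_const n _) (smooth_mult _ _ HI HI)).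
    intros n. specialize (K n). revert K. apply class_C_ext. intros x.
    fold (N x). field. apply HN0.
  - intros u v w Hu. rewrite dotC_mult.
    assert (Hm : 0 < Cmod u) by (apply Cmod_gt_0, Hu).
    assert (Huu : (u * u)%C <> RtoC 0) by (apply Cmult_neq_0; exact Hu).
    assert (E : forall a b : C, Cmod (row_form CZ a b (/ u)) = Cmod (row_form CU a b u) / Cmod u).
    { intros a' b'. rewrite <- Cmod_div by exact Hu. f_equal. simpl. field. exact Hu. }
    rewrite !E, Cmod_opp, Cmod_inv, Cmod_mult by exact Huu.
    assert (K := Hn CU u). field. split; [lra |].
    apply Rgt_not_eq. exact K.
Qed.

(** * Rotations are isometries *)

(** [SO3] says that the rows are orthonormal.  Each row is then the cross
    product of the other two, since the square of the difference is
    [1 - 2 det + 1 = 0]; and the expansion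
    [det * u = (r1.u) (r2 x r3) + (r2.u) (r3 x r1) + (r3.u) (r1 x r2)]
    is a polynomial identity. *)
Lemma SO3_dot (A : M3) (u v : R3) :
  SO3 A -> dot3 (mulmv3 A u) (mulmv3 A v) = dot3 u v.
Proof.
  destruct A as [[[[a1 a2] a3] [[b1 b2] b3]] [[c1 c2] c3]].
  destruct u as [[u1 u2] u3], v as [[v1 v2] v3].
  unfold SO3, det3, mulmv3, dot3, cross3.
  intros (Haa & Hbb & Hcc & Hab & Hac & Hbc & Hdet).
  set (x1 := b2 * c3 - b3 * c2) in *. set (x2 := b3 * c1 - b1 * c3) in *.
  set (x3 := b1 * c2 - b2 * c1) in *.
  set (y1 := c2 * a3 - c3 * a2). set (y2 := c3 * a1 - c1 * a3).
  set (y3 := c1 * a2 - c2 * a1).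
  set (z1 := a2 * b3 - a3 * b2). set (z2 := a3 * b1 - a1 * b3).
  set (z3 := a1 * b2 - a2 * b1).
  assert (sq0 : forall p q r, p * p + q * q + r * r = 0 -> p = 0 /\ q = 0 /\ r = 0)
    by (intros; repeat split; nra).
  assert (X : a1 - x1 = 0 /\ a2 - x2 = 0 /\ a3 - x3 = 0).
  { apply sq0.
    replace (_ + _) with
      ((a1 * a1 + a2 * a2 + a3 * a3) - 2 * (a1 * x1 + a2 * x2 + a3 * x3) +
       ((b1 * b1 + b2 * b2 + b3 * b3) * (c1 * c1 + c2 * c2 + c3 * c3) -
        (b1 * c1 + b2 * c2 + b3 * c3) ^ 2)) by (unfold x1, x2, x3; ring).
    rewrite Haa, Hbb, Hcc, Hbc, Hdet. ring. }
  assert (Y : b1 - y1 = 0 /\ b2 - y2 = 0 /\ b3 - y3 = 0).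
  { apply sq0.
    replace (_ + _) with
      ((b1 * b1 + b2 * b2 + b3 * b3) - 2 * (a1 * x1 + a2 * x2 + a3 * x3) +
       ((a1 * a1 + a2 * a2 + a3 * a3) * (c1 * c1 + c2 * c2 + c3 * c3) -
        (a1 * c1 + a2 * c2 + a3 * c3) ^ 2)) by (unfold x1, x2, x3, y1, y2, y3; ring).
    rewrite Haa, Hbb, Hcc, Hac, Hdet. ring. }
  assert (Z : c1 - z1 = 0 /\ c2 - z2 = 0 /\ c3 - z3 = 0).
  { apply sq0.
    replace (_ + _) with
      ((c1 * c1 + c2 * c2 + c3 * c3) - 2 * (a1 * x1 + a2 * x2 + a3 * x3) +
       ((a1 * a1 + a2 * a2 + a3 * a3) * (b1 * b1 + b2 * b2 + b3 * b3) -
        (a1 * b1 + a2 * b2 + a3 * b3) ^ 2)) by (unfold x1, x2, x3, z1, z2, z3; ring).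
    rewrite Haa, Hbb, Hcc, Hab, Hdet. ring. }
  transitivity ((a1 * x1 + a2 * x2 + a3 * x3) * (u1 * v1 + u2 * v2 + u3 * v3));
    [| rewrite Hdet; ring].
  transitivity ((a1 * u1 + a2 * u2 + a3 * u3) * (x1 * v1 + x2 * v2 + x3 * v3) +
    (b1 * u1 + b2 * u2 + b3 * u3) * (y1 * v1 + y2 * v2 + y3 * v3) +
    (c1 * u1 + c2 * u2 + c3 * u3) * (z1 * v1 + z2 * v2 + z3 * v3));
    [| unfold x1, x2, x3, y1, y2, y3, z1, z2, z3; ring].
  destruct X as (X1 & X2 & X3), Y as (Y1 & Y2 & Y3), Z as (Z1 & Z2 & Z3).
  replace x1 with a1 by lra. replace x2 with a2 by lra. replace x3 with a3 by lra.
  replace y1 with b1 by lra. replace y2 with b2 by lra. replace y3 with b3 by lra.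
  replace z1 with c1 by lra. replace z2 with c2 by lra. replace z3 with c3 by lra.
  reflexivity.
Qed.

Lemma one_plus_Cmod2_pos (x : C) : 0 < 1 + Cmod x ^ 2.
Proof. assert (0 <= Cmod x ^ 2) by apply pow2_ge_0. lra. Qed.

Lemma to_sphere_param_CU (u : C) :
  to_sphere (param CU u) =
  (2 * fst u / (1 + Cmod u ^ 2), - (2 * snd u) / (1 + Cmod u ^ 2),
   (1 - Cmod u ^ 2) / (1 + Cmod u ^ 2)).
Proof.
  destruct (Ceq_dec u (RtoC 0)) as [-> | N].
  - rewrite param_CU_0, Cmod_0. simpl. repeat f_equal; field.
  - rewrite param_CU_neq by exact N. unfold to_sphere.
    rewrite Cmod_inv by exact N. apply Cmod_gt_0 in N.
    assert (E := Cmod2_alt u). unfold Re, Im in E.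
    assert (P := one_plus_Cmod2_pos u).
    assert (N2 : 0 < fst u ^ 2 + snd u ^ 2) by (rewrite <- E; apply pow_lt, N).
    assert (K : forall r, 2 * (r / (fst u ^ 2 + snd u ^ 2)) / (1 + (/ Cmod u) ^ 2) =
                            2 * r / (1 + Cmod u ^ 2)).
    { intros r. rewrite <- E. field. repeat split; nra. }
    unfold Cinv; simpl fst; simpl snd.
    change (fst u * (fst u * 1) + snd u * (snd u * 1)) with (fst u ^ 2 + snd u ^ 2).
    rewrite !K.
    f_equal; [f_equal; field; nra |]. field. nra.
Qed.

(** The right hand side is half the square of the chordal distance, so the
    formula for this distance is the same in the two charts. *)
Lemma to_sphere_dot (s : chart) (x y : C) :
  1 - dot3 (to_sphere (param s x)) (to_sphere (param s y)) =
  2 * Cmod (y - x) ^ 2 / ((1 + Cmod x ^ 2) * (1 + Cmod y ^ 2)).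
Proof.
  assert (Px := one_plus_Cmod2_pos x). assert (Py := one_plus_Cmod2_pos y).
  assert (Ex := Cmod2_alt x). assert (Ey := Cmod2_alt y).
  assert (Exy := Cmod2_alt (y - x)).
  unfold Re, Im in *. rewrite Exy. clear Exy.
  destruct s; [unfold param, to_sphere | rewrite !to_sphere_param_CU];
    unfold dot3; rewrite !Ex, !Ey in *;
    destruct x, y; simpl in *; field; split; lra.
Qed.

Lemma is_lim_Cmod_line (f : C -> C) (x l : C) :
  C_derive_at f x l ->
  is_lim (fun t => 1 + Cmod (f (x + RtoC t)%C) ^ 2) 0 (1 + Cmod (f x) ^ 2).
Proof.
  intros H. apply is_lim_plus'; [apply is_lim_const |].
  assert (K : is_lim (fun t => Cmod (f (x + RtoC t)%C)) 0 (Cmod (f x))).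
  { apply is_lim_spec. intros eps.
    destruct (C_derive_at_continuous f x l H eps (cond_pos eps)) as (d & Hd & Hw).
    exists (mkposreal d Hd). intros t Ht _.
    assert (Ht' : Rabs t < d).
    { replace t with (minus t 0) by (unfold minus, plus, opp; simpl; ring). exact Ht. }
    specialize (Hw (x + RtoC t)%C).
    replace (x + RtoC t - x)%C with (RtoC t) in Hw by ring.
    rewrite Cmod_R in Hw. specialize (Hw Ht').
    assert (T1 := Cmod_triangle (f (x + RtoC t)%C - f x) (f x)).
    assert (T2 := Cmod_triangle (- (f (x + RtoC t)%C - f x)) (f (x + RtoC t)%C)).
    rewrite Cmod_opp in T2.
    replace (f (x + t) - f x + f x)%C with (f (x + RtoC t)%C) in T1 by ring.
    replace (- (f (x + t) - f x) + f (x + t))%C with (f x) in T2 by ring.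
    apply Rabs_def1; lra. }
  apply (is_lim_ext (fun t => Cmod (f (x + RtoC t)%C) * Cmod (f (x + RtoC t)%C)));
    [intros; simpl; ring |].
  replace (Cmod (f x) ^ 2) with (Cmod (f x) * Cmod (f x)) by ring.
  apply (is_lim_mult _ _ 0 (Cmod (f x)) (Cmod (f x))); [exact K | exact K | exact I].
Qed.

Lemma is_lim_Cmod_quotient (f : C -> C) (x l : C) :
  C_derive_at f x l ->
  is_lim (fun t => Cmod (f (x + RtoC t)%C - f x) / Rabs t) 0 (Cmod l).
Proof.
  intros H. apply is_lim_spec. intros eps.
  destruct (proj1 (C_derive_at_eps f x l) H (eps / 2) (is_pos_div_2 eps)) as (d & Hd & Hw).
  exists (mkposreal d Hd). intros t Ht Ht0.
  assert (Ht' : Rabs t < d).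
  { replace t with (minus t 0) by (unfold minus, plus, opp; simpl; ring). exact Ht. }
  specialize (Hw (x + RtoC t)%C).
  replace (x + RtoC t - x)%C with (RtoC t) in Hw by ring.
  rewrite Cmod_R in Hw. specialize (Hw Ht').
  set (D := (f (x + RtoC t) - f x)%C) in *.
  assert (T1 := Cmod_triangle (D - l * t) (l * t)).
  assert (T2 := Cmod_triangle (- (D - l * t)) D).
  rewrite Cmod_opp in T2.
  replace (D - l * t + l * t)%C with D in T1 by ring.
  replace (- (D - l * t) + D)%C with (l * t)%C in T2 by ring.
  rewrite Cmod_mult, Cmod_R in T1, T2.
  assert (P : 0 < Rabs t) by (apply Rabs_pos_lt, Ht0).
  assert (He := cond_pos eps).
  replace (Cmod D / Rabs t - Cmod l) with ((Cmod D - Cmod l * Rabs t) / Rabs t)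
    by (field; lra).
  rewrite Rabs_div by lra. rewrite Rabs_Rabsolu.
  apply Rlt_div_l; [exact P |]. apply Rabs_def1; nra.
Qed.

(** Infinitesimal form of the preservation of chordal distances: divide by
    [|y - x|^2] and let [y] tend to [x], here along a real line. *)
Lemma chordal_isometry_derive (f : C -> C) (x l : C) :
  C_derive_at f x l ->
  locally (T := C_UniformSpace) x (fun y =>
    Cmod (f y - f x) ^ 2 / ((1 + Cmod (f x) ^ 2) * (1 + Cmod (f y) ^ 2)) =
    Cmod (y - x) ^ 2 / ((1 + Cmod x ^ 2) * (1 + Cmod y ^ 2))) ->
  Cmod l ^ 2 * (1 + Cmod x ^ 2) ^ 2 = (1 + Cmod (f x) ^ 2) ^ 2.
Proof.
  intros H N. apply C_near in N. destruct N as (d & Hd & N).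
  assert (Q := is_lim_Cmod_quotient f x l H).
  assert (A := is_lim_Cmod_line (fun y => y) x 1 (C_derive_at_id x)).
  assert (B := is_lim_Cmod_line f x l H). cbv beta in A.
  assert (QQ := is_lim_mult _ _ 0 _ _ Q Q I).
  assert (L := is_lim_mult _ _ 0 _ _ QQ A I).
  assert (L1 := is_lim_scal_l _ (1 + Cmod x ^ 2) 0 _ L).
  assert (R1 := is_lim_scal_l _ (1 + Cmod (f x) ^ 2) 0 _ B).
  assert (E : is_lim (fun t => (1 + Cmod (f x) ^ 2) * (1 + Cmod (f (x + RtoC t)%C) ^ 2)) 0
    (Rbar_mult (1 + Cmod x ^ 2) (Rbar_mult (Rbar_mult (Cmod l) (Cmod l)) (1 + Cmod x ^ 2)))).
  { revert L1. apply is_lim_ext_loc. exists (mkposreal d Hd). intros t Ht Ht0.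
    assert (Ht' : Rabs t < d).
    { replace t with (minus t 0) by (unfold minus, plus, opp; simpl; ring). exact Ht. }
    specialize (N (x + RtoC t)%C).
    replace (x + RtoC t - x)%C with (RtoC t) in N by ring.
    rewrite Cmod_R in N. specialize (N Ht').
    assert (P : 0 < Rabs t) by (apply Rabs_pos_lt, Ht0).
    assert (P1 := one_plus_Cmod2_pos x). assert (P2 := one_plus_Cmod2_pos (x + RtoC t)%C).
    assert (P3 := one_plus_Cmod2_pos (f x)). assert (P4 := one_plus_Cmod2_pos (f (x + RtoC t)%C)).
    set (u := Cmod (f (x + t) - f x)%C) in *. set (p := 1 + Cmod x ^ 2) in *.
    set (q := 1 + Cmod (x + t)%C ^ 2) in *. set (r := 1 + Cmod (f x) ^ 2) in *.
    set (s := 1 + Cmod (f (x + t)%C) ^ 2) in *.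
    replace (p * (u / Rabs t * (u / Rabs t) * q))
      with (u ^ 2 / (r * s) * (p * q * r * s) / Rabs t ^ 2) by (field; lra).
    rewrite N. field. lra. }
  apply is_lim_unique in E. apply is_lim_unique in R1. rewrite R1 in E.
  simpl in E. injection E as E. 
  replace (Cmod l ^ 2 * (1 + Cmod x ^ 2) ^ 2) with
    ((1 + Cmod x ^ 2) * (Cmod l * Cmod l * (1 + Cmod x ^ 2))) by ring.
  simpl. rewrite <- E. ring.
Qed.

Lemma pullback_rotation (h : Chat -> Chat) :
  SO3_Aut h -> pullback h g_sphere = g_sphere.
Proof.
  intros [(Hh & _) (A & HA & Hrot)].
  do 4 (apply functional_extensionality; intro).
  rename x into s, x0 into x, x1 into v, x2 into w.
  unfold pullback. set (t := chart_at (h (param s x))).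
  assert (Hd : in_dom t (h (param s x))) by apply in_dom_chart_at.
  set (f := in_charts s t h).
  assert (HD := holomorphic_derive h s t x Hh Hd). fold f in HD.
  set (D := C_derive f x) in *.
  assert (E : Cmod D ^ 2 * (1 + Cmod x ^ 2) ^ 2 = (1 + Cmod (f x) ^ 2) ^ 2).
  { apply (chordal_isometry_derive f x D HD).
    destruct (Hh s t x Hd) as [N _]. revert N. apply filter_imp. intros y Hy.
    assert (K1 := to_sphere_dot t (f x) (f y)).
    assert (K2 := to_sphere_dot s x y).
    unfold f at 1 2, in_charts in K1. rewrite !param_coord in K1 by assumption.
    rewrite !Hrot, SO3_dot in K1 by exact HA. rewrite K2 in K1.
    unfold Rdiv in *. lra. }
  unfold g_sphere. fold (dotC v w). fold (dotC (D * v) (D * w)). rewrite dotC_mult.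
  rewrite <- E.
  assert (P := one_plus_Cmod2_pos x).
  assert (P' := one_plus_Cmod2_pos (f x)).
  assert (0 < (1 + Cmod (f x) ^ 2) ^ 2) by (apply pow_lt, P').
  field. split; [lra |]. intros K. rewrite K in E. simpl in *. nra.
Qed.

(** * Averages of metrics *)

Definition average (gs : list tensor) : tensor := fun s x v w =>
  / INR (length gs) * fold_right (fun g acc => g s x v w + acc) 0 gs.

Lemma average_Permutation (gs gs' : list tensor) :
  Permutation gs gs' -> average gs = average gs'.
Proof.
  intros H. do 4 (apply functional_extensionality; intro). unfold average.
  rewrite (Permutation_length H). f_equal.
  induction H; simpl; lra.
Qed.

(** The pullback evaluates its argument at a point and vectors that depend
    only on [h]. *)
Lemma pullback_average (h : Chat -> Chat) (gs : list tensor) :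
  pullback h (average gs) = average (map (pullback h) gs).
Proof.
  do 4 (apply functional_extensionality; intro). unfold pullback, average.
  rewrite length_map. f_equal.
  induction gs as [| g gs IH]; simpl; [reflexivity | rewrite IH; reflexivity].
Qed.

Lemma INR_length_pos (A : Type) (l : list A) : l <> nil -> 0 < INR (length l).
Proof.
  destruct l; [congruence |]. intros _. apply lt_0_INR. simpl. lia.
Qed.

Lemma average_constant (g : tensor) (gs : list tensor) :
  gs <> nil -> (forall g', In g' gs -> g' = g) -> average gs = g.
Proof.
  intros H0 H. do 4 (apply functional_extensionality; intro). unfold average.
  assert (P := INR_length_pos _ _ H0).
  replace (fold_right _ _ _) with (INR (length gs) * g x x0 x1 x2); [field; lra |].
  clear H0 P. induction gs as [| g' gs IH]; [simpl; ring |].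
  change (length (g' :: gs)) with (S (length gs)). rewrite S_INR.
  simpl fold_right. rewrite <- IH by (intros; apply H; right; assumption).
  rewrite (H g') by (left; reflexivity). ring.
Qed.

Lemma riemannian_average (gs : list tensor) :
  gs <> nil -> (forall g, In g gs -> riemannian_metric g) ->
  riemannian_metric (average gs).
Proof.
  intros H0 H. assert (P := INR_length_pos _ _ H0).
  apply Rinv_0_lt_compat in P. unfold average.
  set (c := / INR (length gs)) in *. clearbody c.
  split; [| split; [| split; [| split]]].
  - intros s x t v v' w. clear H0.
    induction gs as [| g gs IH]; simpl; [ring |].
    assert (Hg := H g (or_introl eq_refl)). destruct Hg as (Hg & _).
    specialize (IH (fun g' Hg' => H g' (or_intror Hg'))).
    rewrite Hg. lra.
  - intros s x v w. clear H0. f_equal.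
    induction gs as [| g gs IH]; simpl; [reflexivity |].
    assert (Hg := H g (or_introl eq_refl)). destruct Hg as (_ & Hg & _).
    rewrite Hg, IH by (intros; apply H; right; assumption). reflexivity.
  - intros s x v Hv. apply Rmult_lt_0_compat; [exact P |].
    assert (K : forall l, (forall g, In g l -> riemannian_metric g) ->
       0 <= fold_right (fun g acc => g s x v v + acc) 0 l).
    { induction l as [| g l IH]; intros Hl; simpl; [lra |].
      assert (Hg := Hl g (or_introl eq_refl)). destruct Hg as (_ & _ & Hg & _).
      specialize (Hg s x v Hv).
      specialize (IH (fun g' Hg' => Hl g' (or_intror Hg'))). lra. }
    destruct gs as [| g gs]; [congruence | simpl].
    assert (Hg := H g (or_introl eq_refl)). destruct Hg as (_ & _ & Hg & _).
    specialize (Hg s x v Hv).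
    specialize (K gs (fun g' Hg' => H g' (or_intror Hg'))). lra.
  - intros s v w.
    apply (smooth_mult (fun _ => c)); [intros n; apply class_C_const |]. clear H0.
    induction gs as [| g gs IH]; simpl; [intros n; apply class_C_const |].
    apply smooth_plus.
    + assert (Hg := H g (or_introl eq_refl)). apply Hg.
    + apply IH. intros; apply H; right; assumption.
  - intros u v w Hu. f_equal. clear H0.
    induction gs as [| g gs IH]; simpl; [reflexivity |].
    assert (Hg := H g (or_introl eq_refl)). destruct Hg as (_ & _ & _ & _ & Hg).
    rewrite Hg, IH by (try exact Hu; intros; apply H; right; assumption).
    reflexivity.
Qed.

Definition enumerates (K : (Chat -> Chat) -> Prop) (l : list (Chat -> Chat)) : Prop :=
  NoDup l /\ forall h, In h l <-> K h.

(** Some enumeration without repetition; the average does not depend on the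
    choice ([average_Permutation]). *)
Definition elements (K : (Chat -> Chat) -> Prop) : list (Chat -> Chat) :=
  epsilon (inhabits nil) (enumerates K).

Lemma elements_spec (K : (Chat -> Chat) -> Prop) :
  (exists l, forall h, K h -> In h l) -> enumerates K (elements K).
Proof.
  intros [l Hl]. unfold elements. apply epsilon_spec.
  set (dec := fun h k : Chat -> Chat => excluded_middle_informative (h = k)).
  exists (filter (fun h => if excluded_middle_informative (K h) then true else false)
            (nodup dec l)).
  split.
  - apply NoDup_filter, NoDup_nodup.
  - intros h. rewrite filter_In, nodup_In.
    destruct excluded_middle_informative as [Y | N]; split; try tauto.
    + intros _. split; auto.
    + intros [_ E]. discriminate.
Qed.

Definition averaged_metric (K : (Chat -> Chat) -> Prop) : tensor :=
  average (map (fun k => pullback k g_sphere) (elements K)).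

Lemma pullback_averaged_metric (K : (Chat -> Chat) -> Prop) (h : Chat -> Chat) :
  (forall k, In k (elements K) -> holomorphic k) -> holomorphic h ->
  pullback h (averaged_metric K) =
  average (map (fun k => pullback k g_sphere)
               (map (fun k p => k (h p)) (elements K))).
Proof.
  intros HK Hh. unfold averaged_metric. rewrite pullback_average, !map_map.
  f_equal. apply map_ext_in. intros k Hk. apply pullback_comp; auto.
Qed.

Lemma Permutation_map_injective (A B D : Type) (l : list A) (l' : list B)
  (f : A -> D) (g : B -> D) :
  NoDup l -> NoDup l' -> (forall x y, f x = f y -> x = y) ->
  (forall x y, g x = g y -> x = y) ->
  (forall x, In x l -> exists y, In y l' /\ g y = f x) ->
  (forall y, In y l' -> exists x, In x l /\ f x = g y) ->
  Permutation (map f l) (map g l').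
Proof.
  intros Nl Nl' If Ig H1 H2. apply NoDup_Permutation.
  - apply FinFun.Injective_map_NoDup; assumption.
  - apply FinFun.Injective_map_NoDup; assumption.
  - intros d. rewrite !in_map_iff. split.
    + intros (x & <- & Hx). destruct (H1 x Hx) as (y & Hy & E). eauto.
    + intros (y & <- & Hy). destruct (H2 y Hy) as (x & Hx & E). eauto.
Qed.

Lemma precomp_injective (h k : Chat -> Chat) :
  (forall p, h (k p) = p) ->
  forall f g : Chat -> Chat, (fun p => f (h p)) = (fun p => g (h p)) -> f = g.
Proof.
  intros Hhk f g E. apply functional_extensionality. intros p.
  rewrite <- (Hhk p). exact (f_equal (fun m => m (k p)) E).
Qed.

Lemma postcomp_injective (h k : Chat -> Chat) :
  (forall p, k (h p) = p) ->
  forall f g : Chat -> Chat, (fun p => h (f p)) = (fun p => h (g p)) -> f = g.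
Proof.
  intros Hkh f g E. apply functional_extensionality. intros p.
  rewrite <- (Hkh (f p)), <- (Hkh (g p)). f_equal.
  exact (f_equal (fun m => m p) E).
Qed.

(** Right translation by [h] is a permutation of [K]. *)
Lemma averaged_metric_invariant (K : (Chat -> Chat) -> Prop) :
  finite_subgroup_Aut K -> invariant K (averaged_metric K).
Proof.
  intros (HA & _ & Hmul & Hinv & Hfin) h Hh.
  destruct (elements_spec K Hfin) as [Hnd Hin].
  rewrite pullback_averaged_metric.
  2: { intros k Hk. apply HA, Hin, Hk. }
  2: { apply HA, Hh. }
  destruct (Hinv h Hh) as (k & Hk & Hhk & Hkh).
  apply average_Permutation, Permutation_map.
  rewrite <- (map_id (elements K)) at 2.
  apply Permutation_map_injective; try assumption.
  - apply (precomp_injective h k Hhk).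
  - auto.
  - intros m Hm. eexists. split; [| reflexivity].
    apply Hin, Hmul; [apply Hin, Hm | exact Hh].
  - intros m Hm. exists (fun p => m (k p)). split.
    + apply Hin, Hmul; [apply Hin, Hm | exact Hk].
    + apply functional_extensionality. intros p. rewrite Hkh. reflexivity.
Qed.

(** Precomposing the elements [r k r^-1] with [r] gives the maps [r k], and
    [(r k)^* g_sphere = k^* r^* g_sphere = k^* g_sphere]. *)
Lemma averaged_metric_canonical : canonical averaged_metric.
Proof.
  intros K r (HA & _ & _ & _ & Hfin) Hr.
  assert (Hr' := Hr). destruct Hr' as [(Hrh & q & Hqh & Hrq & Hqr) _].
  assert (Hconj : forall h, conj_subgroup r K h <->
            exists k, K k /\ h = fun p => r (k (q p))).
  { intros h. split; intros (k & Hk & E); exists k; (split; [exact Hk |]).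
    - apply functional_extensionality. intros p. rewrite <- E, Hrq. reflexivity.
    - intros p. rewrite E, Hqr. reflexivity. }
  assert (Hfin' : exists l, forall h, conj_subgroup r K h -> In h l).
  { destruct Hfin as [l Hl]. exists (map (fun k p => r (k (q p))) l).
    intros h Hh. apply Hconj in Hh. destruct Hh as (k & Hk & ->).
    apply (in_map (fun (k : Chat -> Chat) p => r (k (q p)))), Hl, Hk. }
  destruct (elements_spec K Hfin) as [Hnd Hin].
  destruct (elements_spec _ Hfin') as [Hnd' Hin'].
  rewrite pullback_averaged_metric; [| | exact Hrh].
  2: { intros h Hh. apply Hin', Hconj in Hh. destruct Hh as (k & Hk & ->).
       apply (holomorphic_comp (fun p => k (q p)) r); [| exact Hrh].
       apply holomorphic_comp; [exact Hqh | apply HA, Hk]. }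
  transitivity (average (map (fun k => pullback k g_sphere)
                  (map (fun k p => r (k p)) (elements K)))).
  - apply average_Permutation, Permutation_map.
    apply Permutation_map_injective; try assumption.
    + apply (precomp_injective r q Hrq).
    + apply (postcomp_injective r q Hqr).
    + intros h Hh. apply Hin', Hconj in Hh. destruct Hh as (k & Hk & ->).
      exists k. split; [apply Hin, Hk |].
      apply functional_extensionality. intros p. rewrite Hqr. reflexivity.
    + intros k Hk. exists (fun p => r (k (q p))). split.
      * apply Hin', Hconj. exists k. split; [apply Hin, Hk | reflexivity].
      * apply functional_extensionality. intros p. rewrite Hqr. reflexivity.
  - unfold averaged_metric. rewrite map_map. f_equal. apply map_ext_in.
    intros k Hk. rewrite <- pullback_comp; [| apply HA, Hin, Hk | exact Hrh].
    rewrite pullback_rotation by exact Hr. reflexivity.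
Qed.

Theorem proposition6 :
  exists G : ((Chat -> Chat) -> Prop) -> tensor,
    canonical G /\
    forall K : (Chat -> Chat) -> Prop,
      finite_subgroup_Aut K ->
      riemannian_metric (G K) /\
      invariant K (G K) /\
      ((forall h : Chat -> Chat, K h -> SO3_Aut h) -> G K = g_sphere).
Proof.
  exists averaged_metric. split; [exact averaged_metric_canonical |].
  intros K HK. assert (HK' := HK). destruct HK' as (HA & Hid & _ & _ & Hfin).
  destruct (elements_spec K Hfin) as [_ Hin].
  assert (Hne : map (fun k => pullback k g_sphere) (elements K) <> nil).
  { intros E. apply map_eq_nil in E. apply Hin in Hid. rewrite E in Hid. exact Hid. }
  split; [| split].
  - apply riemannian_average; [exact Hne |]. intros g Hg.
    apply in_map_iff in Hg. destruct Hg as (k & <- & Hk).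
    destruct (aut_is_moebius k) as (a & b & c & d & Hdet & ->); [apply HA, Hin, Hk |].
    apply riemannian_pullback_moebius, Hdet.
  - apply averaged_metric_invariant, HK.
  - intros HSO. apply average_constant; [exact Hne |]. intros g Hg.
    apply in_map_iff in Hg. destruct Hg as (k & <- & Hk).
    apply pullback_rotation, HSO, Hin, Hk.
Qed.
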